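(* Let $k\ge 3$ be an integer and let $\xi$ be an offspring distribution such that $\mathbf{E}\{\xi\}=1$, $\mathbf{V}\{\xi\}>0$, $\mathbf{E}\{\xi^{k+1}\}<\infty$ and $\mathbf{P}\{\xi\ge k\}>0$. Let $T_n$ be a $\xi$-Galton-Watson tree conditioned to have exactly $n$ nodes, and let $\mathrm{K}(T_n)$ be its $k$-ary register function. Then $$\frac{\mathrm{K}(T_n)}{\log_2\log_2 n}\to\frac{1}{\log_2(k/2)}$$ in probability as $n\to\infty$.
   Context: An offspring distribution is the law of a random variable $\xi$ with values in $\{0,1,2,\dots\}$; write $p_i=\mathbf{P}\{\xi=i\}$. The (unconditional) $\xi$-Galton-Watson tree $T$ is the random rooted ordered tree in which each node independently has $i$ children with probability $p_i$; when $\mathbf{E}\{\xi\}=1$ and $p_1\neq 1$ it is almost surely finite. $|T|$ is its number of nodes. $T_n$ denotes a random tree with the law of $T$ given $|T|=n$; here $n$ ranges only over integers with $\mathbf{P}\{|T|=n\}>0$. $k$-ary register function $\mathrm{K}(T)$ of a finite rooted tree $T$ (for fixed $k\ge2$): it is the height of the largest complete $k$-ary tree that can be embedded in $T$, defined recursively as follows. If $T$ is a single node, $\mathrm{K}(T)=0$. Otherwise, let the root have $\ell\ge1$ children whose subtrees have $k$-ary register functions $\mathrm{K}_1\ge \mathrm{K}_2\ge\cdots\ge \mathrm{K}_\ell$ (sorted). If $\ell\ge k$, then $\mathrm{K}(T)=\mathrm{K}_1+\mathbf{1}_{[\mathrm{K}_1=\cdots=\mathrm{K}_k]}=\max\{\mathrm{K}_1,\mathrm{K}_k+1\}$;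 if $\ell<k$, then $\mathrm{K}(T)=\mathrm{K}_1$. *)

(* Defs.v *)
From HB Require Import structures.
From mathcomp Require Import all_boot all_order all_algebra.
From mathcomp Require Import all_classical all_reals all_analysis.

Set Implicit Arguments.
Unset Strict Implicit.
Unset Printing Implicit Defensive.

Import Order.TTheory GRing.Theory Num.Theory.
Import numFieldNormedType.Exports.

Local Open Scope classical_set_scope.
Local Open Scope ring_scope.

Definition log2 (R : realType) (x : R) : R := ln x / ln 2.

(* Finite rooted ordered trees: a node is the ordered list of the subtrees
   hanging from its children. *)
Inductive otree := Node of seq otree.

Fixpoint otree_size (t : otree) : nat :=
  let: Node ts := t in (sumn [seq otree_size s | s <- ts]).+1.

(* With [ks] sorted in nonincreasing order, K_i is [nth 0 ks i.-1]; a single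
   node has the value 0. *)
Fixpoint register (k : nat) (t : otree) : nat :=
  let: Node ts := t in
  if ts is [::] then 0%N else
  let ks := sort geq [seq register k s | s <- ts] in
  if (k <= size ks)%N then maxn (nth 0%N ks 0) (nth 0%N ks k.-1).+1
  else nth 0%N ks 0.

(* Nodes are named by words (Ulam-Harris labels): the root is [::] and the
   children of u, in order, are rcons u 0, rcons u 1, ...  A word thus lists the
   child indices met on the way down from the root. *)
Fixpoint has_node (t : otree) (u : seq nat) : bool :=
  match u with
  | [::] => true
  | j :: v => let: Node ts := t in
      (j < size ts)%N && has_node (nth (Node [::]) ts j) v
  end.

(* The possibly infinite tree in which the node u has c u children. *)
Inductive grown (c : seq nat -> nat) : set (seq nat) :=
| grown_root : grown c [::]
| grown_child u j : grown c u -> (j < c u)%N -> grown c (rcons u j).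

Section GaltonWatson.
Context d (Omega : measurableType d) (R : realType) (P : probability Omega R).

Definition mutually_independent d' (T : measurableType d') (I : choiceType)
    (X : I -> {RV P >-> T}) : Prop :=
  forall (s : seq I) (A : I -> set T), uniq s -> (forall i, measurable (A i)) ->
  P (\bigcap_(i in [set` s]) (X i @^-1` A i)) =
  (\prod_(i <- s) P (X i @^-1` A i))%E.

(* [xi u] is the number of children of u, whether or not u belongs to the
   tree. *)
Definition GW_family (mu : probability nat R)
    (xi : seq nat -> {RV P >-> nat}) : Prop :=
  mutually_independent xi /\
  forall u (A : set nat), distribution P (xi u) A = mu A.

Variable xi : seq nat -> {RV P >-> nat}.

(* The event that the random tree T is finite and belongs to D. *)
Definition GW_event (D : set otree) : set Omega :=
  [set w | exists2 t, D t & grown (fun u => xi u w) = [set u | has_node t u]].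

Definition GW_size_prob (n : nat) : R :=
  fine (P (GW_event [set t | otree_size t = n])).

(* P{T_n \in D} = P{T \in D | |T| = n}, meaningful when GW_size_prob n > 0. *)
Definition cond_GW_prob (n : nat) (D : set otree) : R :=
  fine (P (GW_event (D `&` [set t | otree_size t = n]))) / GW_size_prob n.

(* f n (T_n) tends to l in probability, along the n with P{|T| = n} > 0. *)
Definition cond_GW_cvg_in_prob (f : nat -> otree -> R) (l : R) : Prop :=
  forall eps : R, 0 < eps ->
  cond_GW_prob n [set t | eps < `|f n t - l|]
    @[n --> within [set n | 0 < GW_size_prob n] \oo] --> (0 : R).

End GaltonWatson.

(* Main.v *)
Require Import Defs.
From HB Require Import structures.
From mathcomp Require Import all_boot all_order all_algebra.
From mathcomp Require Import all_classical all_reals all_analysis.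
From mathcomp Require Import zify ring lra.
Set Implicit Arguments.
Unset Strict Implicit.
Unset Printing Implicit Defensive.
Import Order.TTheory GRing.Theory Num.Theory.
Import numFieldNormedType.Exports.
Local Open Scope ring_scope.

(** Write p_l for the offspring probabilities, K for the register function, and
fix a letter d >= k with p_d > 0.  The probability of a given finite tree is the
product of p_l over its code, the sequence of the numbers of children read in
preorder; so every probability below is a sum of such weights over a finite
list of trees, obtained by bounding the height and the degrees, and every
estimate on trees is an induction on the height that is uniform in these bounds.

The tree has K > m if and only if some child of the root has K > m or at least
k of them have K >= m.  For a critical law the linear terms of this recursion
cancel, and the balance of the next ones, q_{m+1}^2 against q_m^k, makes
q_m = P(K >= m) decay like exp (- const (k/2)^m).  Because this decay is doubly
exponential, any factor polynomial in the number n of nodes is negligible, and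
three estimates suffice.

- Upper tail ([mass_ge_doubly_exp]).  The recursion gives
  q_{m+1} <= q_{m+1} - p_d q_{m+1}^2 + C q_m^k, and a first, crude form of it
  shows that q_m is eventually as small as one wants, so that the doubly
  exponential regime is reached.

- Lower tail ([mass_size_lt]).  Weigh a tree with n nodes by z^n times its
  probability.  The total weight of the trees with K < m is at most 1 even for
  z = 1 + const exp (- const (k/2)^m), because forbidding K >= m leaves room of
  that order in the recursion; hence P(K < m and |T| = n) <= z^(-n).  With
  (k/2)^m = (log n)^(1 - delta) this is smaller than every power of n.

- Conditioning ([GW_size_prob_lower]).  P(|T| = n) >= c / n^2 along the sizes of
  positive probability.  Rotating a word of n letters and sum n - 1 suitably
  gives the code of a tree, so n P(|T| = n) is at least the probability that n
  independent letters have sum n - 1.  That one is at least const / n: the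
  letters 0 and d are merged, a second moment bound controls all the rest, the
  choice between 0 and d is binomial and charges every point of a window of
  order sqrt n around its mean, and a bounded number of reserved letters adjusts
  the residue modulo d.

Dividing the two tails by c / n^2 gives the limit, since (k/2)^m = log n at
m = log log n / log (k/2). *)

(** * Weighted words *)

(** Words of length [n] over the alphabet [s]; a list rather than a finite type,
so that the alphabet can itself be a list of trees. *)
Fixpoint lprod (T : Type) (n : nat) (s : seq T) : seq (seq T) :=
  if n is n'.+1 then [seq x :: xs | x <- s, xs <- lprod n' s] else [:: [::]].

Lemma lprodP (T : eqType) n (s xs : seq T) :
  (xs \in lprod n s) = (size xs == n) && all [in s] xs.
Proof.
elim: n xs => [|n IHn] [|x xs] //=; first by apply/negbTE/allpairsP => -[[a b] []].
apply/allpairsP/idP => [[[y ys] /= [ys_s + [-> ->]]]|].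
  by rewrite IHn ys_s eqSS.
by rewrite eqSS andbCA -IHn => /andP[xs_in x_in]; exists (x, xs).
Qed.

Lemma lprod_uniq (T : eqType) n (s : seq T) : uniq s -> uniq (lprod n s).
Proof.
move=> us; elim: n => //= n IHn; apply: allpairs_uniq => //.
by move=> [x xs] [y ys] _ _ [-> ->].
Qed.

Section WordWeights.
Variables (R : comPzRingType) (T : Type).
Implicit Types (g : T -> R) (s xs : seq T).

Definition wt g xs : R := \prod_(x <- xs) g x.

Lemma wt_nil g : wt g [::] = 1. Proof. exact: big_nil. Qed.
Lemma wt_cons g x xs : wt g (x :: xs) = g x * wt g xs. Proof. exact: big_cons. Qed.
Lemma wt_cat g xs ys : wt g (xs ++ ys) = wt g xs * wt g ys.
Proof. exact: big_cat. Qed.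

Lemma sum_lprod0 (F : seq T -> R) s : \sum_(xs <- lprod 0 s) F xs = F [::].
Proof. exact: big_seq1. Qed.

Lemma sum_lprodS n (F : seq T -> R) s :
  \sum_(xs <- lprod n.+1 s) F xs =
  \sum_(x <- s) \sum_(xs <- lprod n s) F (x :: xs).
Proof. exact: big_allpairs_dep. Qed.

Lemma sum_lprodD m n (F : seq T -> R) s :
  \sum_(xs <- lprod (m + n) s) F xs =
  \sum_(xs <- lprod m s) \sum_(ys <- lprod n s) F (xs ++ ys).
Proof.
elim: m F => [|m IHm] F; first by rewrite sum_lprod0.
rewrite addSn !sum_lprodS; apply: eq_bigr => x _.
exact: (IHm (fun xs => F (x :: xs))).
Qed.

Lemma sum_lprod_wtS g n (P : pred (seq T)) s :
  \sum_(xs <- lprod n.+1 s | P xs) wt g xs =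
  \sum_(x <- s) g x * \sum_(xs <- lprod n s | P (x :: xs)) wt g xs.
Proof.
rewrite big_mkcond sum_lprodS; apply: eq_bigr => x _.
rewrite mulr_sumr -big_mkcond; apply: eq_bigr => xs _; exact: wt_cons.
Qed.

Lemma sum_lprod_wt g n s :
  \sum_(xs <- lprod n s) wt g xs = (\sum_(x <- s) g x) ^+ n.
Proof.
elim: n => [|n IHn]; first by rewrite sum_lprod0 wt_nil expr0.
rewrite sum_lprod_wtS exprS mulr_suml; apply: eq_bigr => x _.
by rewrite IHn.
Qed.

Lemma sum_lprod_all g (A : pred T) n s :
  \sum_(xs <- lprod n s | all A xs) wt g xs = (\sum_(x <- s | A x) g x) ^+ n.
Proof.
elim: n => [|n IHn]; first by rewrite big_mkcond sum_lprod0 wt_nil expr0.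
rewrite sum_lprod_wtS exprS mulr_suml [RHS]big_mkcond; apply: eq_bigr => x _ /=.
by case: (A x) => /=; rewrite ?IHn // big_pred0_eq mulr0.
Qed.

End WordWeights.

Lemma wt_ge0 (R : realFieldType) (T : Type) (g : T -> R) xs :
  (forall x, 0 <= g x) -> 0 <= wt g xs.
Proof. by move=> g_ge0; apply: prodr_ge0. Qed.

Lemma le_sum_pred (R : realFieldType) (T : Type) (F : T -> R) (P Q : pred T) s :
  (forall x, 0 <= F x) -> (forall x, P x -> Q x) ->
  \sum_(x <- s | P x) F x <= \sum_(x <- s | Q x) F x.
Proof.
move=> F0 PQ; rewrite [leLHS]big_mkcond [leRHS]big_mkcond; apply: ler_sum => x _.
by case: ifP => [/PQ ->//|_]; case: ifP.
Qed.

Lemma sum_pred_le (R : realFieldType) (T : Type) (F : T -> R) (P : pred T) s :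
  (forall x, 0 <= F x) -> \sum_(x <- s | P x) F x <= \sum_(x <- s) F x.
Proof. by move=> F0; exact: le_sum_pred. Qed.

Section MarkedLetters.
Variables (R : realFieldType) (T : Type) (g : T -> R) (s : seq T).
Hypothesis g_ge0 : forall x, 0 <= g x.
Implicit Types A B : pred T.

Lemma sum_lprod_ge0 n (P : pred (seq T)) :
  0 <= \sum_(xs <- lprod n s | P xs) wt g xs.
Proof. by apply: sumr_ge0 => xs _; exact: wt_ge0. Qed.

Hypothesis mass1 : \sum_(x <- s) g x <= 1.

Lemma sum_lprod_le1 n (P : pred (seq T)) :
  \sum_(xs <- lprod n s | P xs) wt g xs <= 1.
Proof.
apply: le_trans (sum_pred_le _ _ _) _; first by move=> xs; exact: wt_ge0.
by rewrite sum_lprod_wt exprn_ile1 ?sumr_ge0.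
Qed.

(** A union bound that keeps the second order term: the right-hand side is the
probability of at least one mark when the letters are independent and marked with
probability [q].  In the induction, with [e] the marked mass of the other letters,
a mark at the first letter can add at most [q * (1 - e)]. *)
Lemma sum_lprod_has A (q : R) n : q <= 1 ->
  \sum_(x <- s | A x) g x <= q ->
  \sum_(xs <- lprod n s | has A xs) wt g xs <= 1 - (1 - q) ^+ n.
Proof.
move=> q1 Aq; elim: n => [|n IHn].
  by rewrite big_mkcond sum_lprod0 /= expr0 subrr.
rewrite sum_lprod_wtS /= exprS.
set e := \sum_(xs <- lprod n s | has A xs) wt g xs in IHn *.
set u := \sum_(xs <- lprod n s) wt g xs.
have e_le_u : e <= u by apply: sum_pred_le => xs; exact: wt_ge0.
have u1 : u <= 1 by exact: (@sum_lprod_le1 n predT).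
have e0 : 0 <= e by exact: sum_lprod_ge0.
have -> : \sum_(x <- s) g x * (\sum_(xs <- lprod n s | A x || has A xs) wt g xs)
          = (\sum_(x <- s | A x) g x) * (u - e) + (\sum_(x <- s) g x) * e.
  rewrite 2!mulr_suml [X in _ = X + _]big_mkcond -big_split /=.
  by apply: eq_bigr => x _; case: (A x) => /=; rewrite -?/e -?/u; ring.
have : (\sum_(x <- s | A x) g x) * (u - e) <= q * (1 - e).
  by apply: ler_pM => //; [apply: sumr_ge0|rewrite subr_ge0|lra].
have : (\sum_(x <- s) g x) * e <= e by rewrite ler_piMl.
have : (1 - q) * e <= (1 - q) * (1 - (1 - q) ^+ n) by rewrite ler_wpM2l //; lra.
lra.
Qed.

(** Union bound over the positions of [k] marked letters; the induction is Pascal's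
rule. *)
Lemma sum_lprod_count A (q : R) n k : \sum_(x <- s | A x) g x <= q ->
  \sum_(xs <- lprod n s | (k <= count A xs)%N) wt g xs <= 'C(n, k)%:R * q ^+ k.
Proof.
move=> Aq; have q0 : 0 <= q by apply: le_trans Aq; apply: sumr_ge0.
elim: n k => [|n IHn] [|k].
- by rewrite mul1r expr0; apply: sum_lprod_le1.
- by rewrite big_mkcond sum_lprod0 /= mul0r.
- by rewrite bin0 expr0 mulr1; apply: sum_lprod_le1.
rewrite sum_lprod_wtS binS natrD mulrDl /=.
set c0 := \sum_(xs <- lprod n s | (k <= count A xs)%N) wt g xs.
set c1 := \sum_(xs <- lprod n s | (k < count A xs)%N) wt g xs.
have c01 : c1 <= c0.
  rewrite /c0 /c1 [leLHS]big_mkcond [leRHS]big_mkcond; apply: ler_sum => xs _.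
  case: ifP => [/ltnW->//|_]; case: ifP => // _; exact: wt_ge0.
have -> : \sum_(x <- s) g x * (\sum_(xs <- lprod n s | (k < A x + count A xs)%N) wt g xs)
          = (\sum_(x <- s | A x) g x) * (c0 - c1) + (\sum_(x <- s) g x) * c1.
  rewrite 2!mulr_suml [X in _ = X + _]big_mkcond -big_split /=.
  by apply: eq_bigr => x _; case: (A x) => /=; rewrite ?add1n ?add0n -/c0 -/c1; ring.
have c1_0 : 0 <= c1 by exact: sum_lprod_ge0.
have c0_0 : 0 <= c0 by exact: sum_lprod_ge0.
have H1 : (\sum_(x <- s | A x) g x) * (c0 - c1) <= q * c0.
  by apply: ler_pM => //; [apply: sumr_ge0|rewrite subr_ge0|lra].
have H2 : (\sum_(x <- s) g x) * c1 <= c1 by rewrite ler_piMl.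
have H3 : q * c0 <= q * ('C(n, k)%:R * q ^+ k) by rewrite ler_wpM2l //; exact: IHn.
have := IHn k.+1; rewrite -/c1 => H4; rewrite exprS in H4 *; lra.
Qed.

End MarkedLetters.

(** If fewer than [k] letters are in [B], the first [k] are not all in [B]; this is
where the subtracted term comes from.  The bound has to be monotone in the masses
of [A] and of [A] without [B], although their difference, the mass of [A] and [B],
is not; writing the recursion with the nonnegative increments
[r m j.+1 - r m j] makes this visible. *)
Lemma sum_lprod_all_count (R : realFieldType) (T : Type) (g : T -> R) s
    (A B : pred T) (X Y : R) n k : (forall x, 0 <= g x) ->
  \sum_(x <- s | A x) g x <= X -> \sum_(x <- s | A x && ~~ B x) g x <= Y ->
  Y <= X -> (k <= n)%N ->
  \sum_(xs <- lprod n s | all A xs && (count B xs < k)%N) wt g xs <=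
  X ^+ n - (X - Y) ^+ k * X ^+ (n - k).
Proof.
move=> g0 AX AY YX.
have X0 : 0 <= X by apply: le_trans AX; apply: sumr_ge0.
have Y0 : 0 <= Y by apply: le_trans AY; apply: sumr_ge0.
pose r n k := \sum_(xs <- lprod n s | all A xs && (count B xs < k)%N) wt g xs.
have r0 m j : 0 <= r m j by exact: sum_lprod_ge0.
have rS m j : r m.+1 j.+1 =
    (\sum_(x <- s | A x) g x) * r m j
    + (\sum_(x <- s | A x && ~~ B x) g x) * (r m j.+1 - r m j).
  rewrite /r sum_lprod_wtS 2!mulr_suml.
  rewrite [X in _ = X + _]big_mkcond [X in _ = _ + X]big_mkcond -big_split /=.
  apply: eq_bigr => x _; case: (A x) => /=; last by rewrite big_pred0_eq; ring.
  by case: (B x) => /=; rewrite ?add1n ?add0n ?ltnS; ring.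
have r_mono m j : r m j <= r m j.+1.
  rewrite /r [leLHS]big_mkcond [leRHS]big_mkcond; apply: ler_sum => xs _.
  case: ifP => [/andP[-> cj] /=|_]; first by rewrite ltnS ltnW.
  by case: ifP => // _; exact: wt_ge0.
have step m j : r m.+1 j.+1 <= (X - Y) * r m j + Y * r m j.+1.
  rewrite rS; have := r_mono m j; rewrite -subr_ge0 => rm.
  have := ler_wpM2r (r0 m j) AX; have := ler_wpM2r rm AY; lra.
have rX m j : r m j <= X ^+ m.
  elim: m j => [|m IHm] [|j].
  - by rewrite /r big_pred0 // => xs; rewrite ltn0 andbF.
  - by rewrite /r big_mkcond sum_lprod0 wt_nil.
  - rewrite /r big_pred0 ?exprn_ge0 // => xs; by rewrite ltn0 andbF.
  apply: le_trans (step m j) _; rewrite exprS.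
  have XY : 0 <= X - Y by rewrite subr_ge0.
  have := ler_wpM2l XY (IHm j); have := ler_wpM2l Y0 (IHm j.+1); lra.
rewrite -/(r n k).
elim: n k => [|n IHn] [|k] // kn.
- by rewrite /r big_pred0 ?expr0 ?subn0 ?mulr1 ?subrr // => xs; rewrite ltn0 andbF.
- rewrite /r big_pred0 ?expr0 ?subn0 ?mul1r ?subrr // => xs; by rewrite ltn0 andbF.
apply: le_trans (step n k) _.
have XY : 0 <= X - Y by rewrite subr_ge0.
have := ler_wpM2l XY (IHn k kn); have := ler_wpM2l Y0 (rX n k.+1).
rewrite subSS !exprS mulrBr.
set a := X ^+ n; set b := (X - Y) ^+ k; set c := X ^+ _; nra.
Qed.

(** * Finite trees, their codes and the register function *)

(** The automatic induction principle ignores the subtrees, which occur inside a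
list. *)
Fixpoint otree_ind_all (Q : otree -> Prop)
    (QNode : forall ts, (forall j, (j < size ts)%N -> Q (nth (Node [::]) ts j)) ->
       Q (Node ts)) (t : otree) : Q t :=
  let: Node ts := t in
  QNode ts ((fix aux (us : seq otree) : forall j, (j < size us)%N ->
        Q (nth (Node [::]) us j) :=
     match us with
     | [::] => fun j lt_j => False_ind _ (notF lt_j)
     | u :: us' => fun j => match j with
         | 0 => fun _ => otree_ind_all QNode u
         | j'.+1 => fun lt_j => aux us' j' lt_j
         end
     end) ts).

Lemma nth_sort_geq (s : seq nat) i m : (i < size s)%N ->
  (m <= nth 0%N (sort geq s) i)%N = (i < count (leq m) s)%N.
Proof.
move=> i_s; set r := sort geq s.
have r_sorted : sorted geq r by apply: sort_sorted => a b; apply: leq_total.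
have sr : size r = size s by rewrite size_sort.
rewrite -(permP (permEl (perm_sort geq s)) (leq m)) -/r.
rewrite -sr in i_s; rewrite {sr}.
elim: r i r_sorted i_s => // a r IHr i /= ar.
have all_a : all (geq a) r.
  by apply: order_path_min ar => b c e cb ec; apply: leq_trans ec cb.
have r_sorted := path_sorted ar.
case: (leqP m a) => [ma|am].
  by case: i => [|i]; rewrite /= ?ma ?add1n ?ltnS // => /IHr ->.
have c0 : count (leq m) r = 0%N.
  apply/eqP; rewrite -leqn0 leqNgt -has_count; apply/hasPn => b br.
  by rewrite -ltnNge (leq_ltn_trans _ am) //; exact: (allP all_a).
rewrite c0 ltn0; case: i => [|i] i_s /=; first by apply/negbTE; rewrite -ltnNge.
by rewrite IHr // c0.
Qed.

(** The recursion for the register function without any sorting: both cases of its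
definition are about how many children reach a level. *)
Lemma register_gt k m ts : (0 < k)%N ->
  (m < register k (Node ts))%N =
  has (fun t => m < register k t)%N ts
  || (k <= count (fun t => m <= register k t)%N ts)%N.
Proof.
move=> k0; case: ts => [|t ts]; first by case: k k0.
have H i j : (j < size (t :: ts))%N ->
   (i <= nth 0 (sort geq [seq register k u | u <- t :: ts]) j)%N
   = (j < count (fun u => i <= register k u)%N (t :: ts))%N.
  by move=> ?; rewrite nth_sort_geq ?size_map // count_map.
rewrite has_count.
rewrite [register _ _]/= -/(map (register k) (t :: ts)) size_sort size_map.
case: ifP => kts.
  by rewrite leq_max ltnS (H m.+1 0%N) // (H m k.-1) ?prednK.
have -> : (k <= count (fun t0 => m <= register k t0) (t :: ts))%N = false.
  apply/negbTE; rewrite -ltnNge; apply: leq_ltn_trans (count_size _ _) _.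
  by rewrite ltnNge kts.
by rewrite orbF H.
Qed.

(** Bounding both the height and the degrees makes the list finite and keeps the
recursion an exact product, which turns sums over trees into sums over words of
trees. *)
Fixpoint trees (N h : nat) : seq otree :=
  if h is h'.+1 then
    flatten [seq [seq Node ts | ts <- lprod l (trees N h')] | l <- iota 0 N]
  else [::].

(** The Lukasiewicz word of the tree. *)
Fixpoint code (t : otree) : seq nat :=
  let: Node ts := t in size ts :: flatten [seq code s | s <- ts].

Lemma code_Node ts : code (Node ts) = size ts :: flatten (map code ts).
Proof. by []. Qed.

(** Reading a code from right to left, a stack holds the trees that are complete;
a letter [l] collects the [l] topmost ones under a new root. *)
Definition push_letter (l : nat) (st : seq otree) : seq otree :=
  Node (take l st) :: drop l st.

Definition parse (x : seq nat) : seq otree := foldr push_letter [::] x.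

Lemma foldr_code t st : foldr push_letter st (code t) = t :: st.
Proof.
elim/otree_ind_all: t st => ts IHts st; rewrite code_Node /=.
have -> : foldr push_letter st (flatten [seq code i | i <- ts]) = ts ++ st.
  elim: ts IHts => [|t ts IH] //= IHts; rewrite foldr_cat IH => [|j j_ts].
    by rewrite (IHts 0).
  exact: (IHts j.+1).
by rewrite /push_letter take_size_cat // drop_size_cat.
Qed.

Lemma codeK : pcancel code (ohead \o parse).
Proof. by move=> t; rewrite /= /parse foldr_code. Qed.

HB.instance Definition _ := Choice.copy otree (pcan_type codeK).

Lemma size_code t : size (code t) = otree_size t.
Proof.
elim/otree_ind_all: t => ts IHts; rewrite code_Node /= size_flatten; congr S.
rewrite /shape -map_comp; congr sumn.
apply: (@eq_from_nth _ 0%N); rewrite !size_map // => i i_ts.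
by rewrite !(nth_map (Node [::])) //= IHts.
Qed.

Lemma sumn_code t : (sumn (code t)).+1 = otree_size t.
Proof.
elim/otree_ind_all: t => ts IHts; rewrite code_Node /=.
have -> // : (size ts + sumn (flatten [seq code i | i <- ts])
  = sumn [seq otree_size s | s <- ts])%N.
  elim: ts IHts => [|t ts IH] //= IHts; rewrite sumn_cat -IH => [|j j_ts].
    by rewrite -(IHts 0) //=; lia.
  exact: (IHts j.+1).
Qed.

(** The suffix condition says that the stack is never too short, since reading
a suffix leaves its length minus its sum trees on the stack. *)
Lemma parseK (x : seq nat) :
  (forall i, (i < size x)%N -> (sumn (drop i x) < size (drop i x))%N) ->
  flatten (map code (parse x)) = x /\ (size (parse x) + sumn x = size x)%N.
Proof.
elim: x => //= l x IHx good.
have [|codeE sizeE] := IHx.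
  by move=> i i_x; exact: (good i.+1).
have := good 0 isT; rewrite drop0 /= ltnS => lx.
have l_le : (l <= size (parse x))%N by lia.
rewrite /parse /= -/(parse x) size_take_min (minn_idPl l_le) size_drop -flatten_cat -map_cat cat_take_drop.
by rewrite codeE; split=> //; lia.
Qed.

Lemma nth_le_sumn s j : (nth 0%N s j <= sumn s)%N.
Proof.
elim: s j => [|a s IHs] [|j] //=; first by rewrite leq_addr.
by rewrite (leq_trans (IHs j)) // leq_addl.
Qed.

Lemma trees_complete N h t :
  (otree_size t <= h)%N -> (otree_size t <= N)%N -> t \in trees N h.
Proof.
elim/otree_ind_all: t N h => ts IHts N [|h] // t_h t_N.
have size_nth j : (j < size ts)%N -> (otree_size (nth (Node [::]) ts j) < otree_size (Node ts))%N.
  move=> j_ts; rewrite /= ltnS -(nth_map _ 0%N) //.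
  exact: nth_le_sumn.
apply/flatten_mapP; exists (size ts).
  rewrite mem_iota /= add0n; apply: leq_trans t_N.
  rewrite ltnS; elim: ts {IHts t_h size_nth} => //= t ts IH.
  by case: t => us /=; rewrite addSn ltnS (leq_trans IH) // leq_addl.
apply: map_f; rewrite lprodP eqxx /=; apply/(all_nthP (Node [::])) => j j_ts.
by apply: IHts => //; have := size_nth _ j_ts; lia.
Qed.

Lemma trees_uniq N h : uniq (trees N h).
Proof.
elim: h => //= h IHh.
apply: (@allpairs_uniq_dep _ _ _ (fun _ ts => Node ts)); first exact: iota_uniq.
  by move=> l _; exact: lprod_uniq.
move=> [l ts] [l' ts'] /allpairsPdep[m [us [_ us_in [-> ->]]]].
move=> /allpairsPdep[m' [us' [_ us_in' [-> ->]]]] [eq_us].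
move: us_in us_in'; rewrite !lprodP eq_us => /andP[/eqP <- _] /andP[/eqP <- _].
by [].
Qed.

Section TreeWeights.
Variables (R : realFieldType) (g : nat -> R).

Definition tree_wt (t : otree) : R := wt g (code t).

Lemma tree_wt_Node ts : tree_wt (Node ts) = g (size ts) * wt tree_wt ts.
Proof.
rewrite /tree_wt code_Node wt_cons; congr (_ * _).
by elim: ts => [|t ts IH] /=; rewrite ?wt_nil // wt_cat IH wt_cons.
Qed.

Lemma sum_trees N h (P : pred otree) :
  \sum_(t <- trees N h.+1 | P t) tree_wt t =
  \sum_(0 <= l < N) g l *
     \sum_(ts <- lprod l (trees N h) | P (Node ts)) wt tree_wt ts.
Proof.
rewrite /= big_flatten /= big_map /index_iota subn0; apply: eq_bigr => l _.
rewrite big_map mulr_sumr big_seq_cond [RHS]big_seq_cond.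
apply: eq_bigr => ts; rewrite lprodP => /andP[/andP[/eqP sz _] _].
by rewrite tree_wt_Node sz.
Qed.

Hypothesis g_ge0 : forall l, 0 <= g l.

Lemma tree_wt_ge0 t : 0 <= tree_wt t.
Proof. exact: wt_ge0. Qed.

Lemma sum_trees_le1 N h (P : pred otree) : \sum_(0 <= l < N) g l <= 1 ->
  \sum_(t <- trees N h | P t) tree_wt t <= 1.
Proof.
move=> g1; elim: h P => [|h IHh] P; first by rewrite big_nil ler01.
rewrite sum_trees; apply: le_trans g1; apply: ler_sum => l _.
rewrite ler_piMr // sum_lprod_le1 //; exact: tree_wt_ge0.
Qed.

End TreeWeights.

(** * Half of the cycle lemma *)

Lemma sumn_drop x i : (sumn (take i x) + sumn (drop i x) = sumn x)%N.
Proof. by rewrite -sumn_cat cat_take_drop. Qed.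

(** Cut the word just after the shortest prefix that maximizes length minus sum.  In
the rotated word a suffix ends at that cut, and by maximality its length is at
least its sum; the inequality is strict because of minimality for the suffixes of
the first part, and because the whole word has length minus sum equal to 1 for the
others. *)
Lemma rotation_suffixes (x : seq nat) : (sumn x).+1 = size x ->
  exists2 r, (r < size x)%N & forall i, (i < size x)%N ->
    (sumn (drop i (rot r x)) < size (drop i (rot r x)))%N.
Proof.
move=> sx; have n0 : (0 < size x)%N by rewrite -sx.
pose s i := sumn (take i x).
have s_le i : (s i <= sumn x)%N by rewrite -(sumn_drop x i) leq_addr.
pose v i := (i + size x - s i)%N.
have [r0 _ r0_max] := @arg_maxnP _ (Ordinal n0) xpredT (fun i : 'I__ => v i) isT.
have [|r /andP[r_x /eqP vr] r_min] :=
    @ex_minnP (fun r => (r < size x)%N && (v r == v r0)).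
  by exists r0; rewrite ltn_ord eqxx.
have v_le i : (i < size x)%N -> (v i <= v r)%N.
  by move=> i_x; rewrite vr; exact: (r0_max (Ordinal i_x)).
have v_lt i : (i < r)%N -> (v i < v r)%N.
  move=> i_r; have i_x := ltn_trans i_r r_x.
  rewrite ltn_neqAle v_le // andbT; apply/negP => vi.
  by have := r_min i; rewrite i_x (eqP vi) vr eqxx => /(_ isT); lia.
exists r => // i i_x; rewrite size_drop size_rot /rot.
rewrite drop_cat size_drop; case: (ltnP i (size x - r)) => [i_lt|i_ge].
  rewrite sumn_cat drop_drop -/(s r).
  have := sumn_drop x (i + r); rewrite -/(s _).
  have := v_le (i + r)%N; have := s_le r; have := s_le (i + r)%N; rewrite /v; lia.
set j := (i - (size x - r))%N.
have j_r : (j < r)%N by rewrite /j; lia.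
have := sumn_drop (take r x) j; rewrite take_takel ?(ltnW j_r) // -/(s r) -/(s j).
have := v_lt _ j_r; have := s_le r; have := s_le j; rewrite /v /j; lia.
Qed.

Lemma rotation_code (x : seq nat) : (sumn x).+1 = size x ->
  exists2 r, (r < size x)%N & exists2 t, code t = rot r x & otree_size t = size x.
Proof.
move=> sx; have [r r_x good] := rotation_suffixes sx; exists r => //.
have [|] := @parseK (rot r x); first by rewrite size_rot.
have srot : sumn (rot r x) = sumn x.
  by rewrite /rot sumn_cat addnC sumn_drop.
case: (parse (rot r x)) => [|t [|u us]]; rewrite /= srot size_rot -sx.
- by lia.
- by rewrite cats0 => tE _; exists t; rewrite // -size_code tE size_rot sx.
- by lia.
Qed.

Lemma uniq_sub_sum (R : realFieldType) (T : eqType) (F : T -> R) (s s' : seq T) :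
  (forall x, 0 <= F x) -> uniq s -> uniq s' -> {subset s <= s'} ->
  \sum_(x <- s) F x <= \sum_(x <- s') F x.
Proof.
move=> F0 us us' sub.
rewrite (perm_big [seq x <- s' | x \in s]); last first.
  apply: uniq_perm => //; first exact: filter_uniq.
  by move=> x; rewrite mem_filter; case: (boolP (x \in s)) => // /sub ->.
by rewrite big_filter; exact: sum_pred_le.
Qed.

(** One half of the Otter-Dwass formula.  The [n] rotations of a word have the same
weight and at least one of them is a code. *)
Lemma sum_words_le_trees (R : realFieldType) (g : nat -> R) N n :
  (forall l, 0 <= g l) -> (n <= N)%N ->
  \sum_(x <- lprod n (iota 0 N) | (sumn x).+1 == n) wt g x <=
  n%:R * \sum_(t <- trees N n | otree_size t == n) tree_wt g t.
Proof.
move=> g0 n_N; set a := \sum_(t <- trees N n | _) _.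
set W := lprod n (iota 0 N).
pose is_code x := x \in [seq code t | t <- trees N n & otree_size t == n].
have uW : uniq W by apply: lprod_uniq; apply: iota_uniq.
have W_size x : x \in W -> size x = n by rewrite lprodP => /andP[/eqP].
have code_mass : \sum_(x <- W | is_code x) wt g x <= a.
  have -> : a = \sum_(x <- [seq code t | t <- trees N n & otree_size t == n]) wt g x.
    by rewrite big_map big_filter.
  rewrite -big_filter.
  apply: uniq_sub_sum; first by move=> x; exact: wt_ge0.
  - exact: filter_uniq.
  - rewrite map_inj_uniq ?filter_uniq ?trees_uniq //; exact: pcan_inj codeK.
  - by move=> x; rewrite mem_filter => /andP[].
have rot_mass r : \sum_(x <- W | is_code (rot r x)) wt g x <= a.
  apply: le_trans code_mass.
  rewrite [leRHS](perm_big [seq rot r x | x <- W]); last first.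
    apply: uniq_perm => //; first by rewrite map_inj_uniq //; exact: rot_inj.
    move=> x; apply/idP/mapP => [xW|[y yW ->]].
      exists (rotr r x); last by rewrite rotrK.
      move: xW; rewrite !lprodP size_rotr => /andP[-> /=].
      by rewrite (eq_all_r (mem_rotr _ _)).
    by move: yW; rewrite !lprodP size_rot (eq_all_r (mem_rot _ _)).
  rewrite big_map; apply: ler_sum => x _.
  by rewrite /wt (perm_big (rot r x)) // perm_sym perm_rot.
rewrite mulr_natl -[n in _ *+ n]card_ord -sumr_const.
apply: le_trans (ler_sum _ (fun (r : 'I_n) _ => rot_mass r)).
rewrite (exchange_big_dep xpredT) //= big_mkcond /=.
rewrite big_seq [leRHS]big_seq; apply: ler_sum => x xW.
case: ifP => [/eqP sx|_]; last by apply: sumr_ge0 => r _; exact: wt_ge0.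
have sz := W_size _ xW; rewrite -sz in sx.
have [r r_x [t tE t_size]] := rotation_code sx.
rewrite sz in r_x.
rewrite (bigD1 (Ordinal r_x)) /=.
  by rewrite lerDl; apply: sumr_ge0 => r' _; exact: wt_ge0.
rewrite /is_code -tE map_f // mem_filter t_size sz eqxx /=.
by apply: trees_complete; rewrite t_size sz.
Qed.

(** * The register function of the unconditioned tree *)

Lemma bernoulli_le (R : realFieldType) (b : R) l : 0 <= b <= 1 ->
  1 - l%:R * b <= (1 - b) ^+ l.
Proof.
move=> /andP[b0 b1]; elim: l => [|l IHl]; first by rewrite mul0r subr0 expr0.
rewrite exprS -natr1; have l0 : 0 <= l%:R :> R by [].
have b1' : 0 <= 1 - b by lra.
have := ler_wpM2l b1' IHl; have := mulr_ge0 l0 (sqr_ge0 b); lra.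
Qed.

Lemma bernoulli_le_sqr (R : realFieldType) (b : R) l : 0 <= b <= 1 ->
  (1 < l)%N -> 1 - l%:R * b + b ^+ 2 <= (1 - b) ^+ l.
Proof.
move=> b01; case: l => [|[|l]] // _; elim: l => [|l IHl]; first lra.
have := bernoulli_le l.+2 b01; move: b01 IHl => /andP[b0 b1].
rewrite [_ ^+ l.+3]exprS -(natr1 l.+2) => IHl.
have b1' : 0 <= 1 - b by lra.
have l0 : 0 <= l.+2%:R - 1 :> R by rewrite subr_ge0 (ler_nat R 1).
have := ler_wpM2l b1' IHl; have := mulr_ge0 l0 (sqr_ge0 b).
have := mulr_ge0 (sqr_ge0 b) b1'.
set x := (1 - b) ^+ _; nra.
Qed.

Lemma expr1B_le (R : realFieldType) (b : R) l : 0 <= b <= 1 ->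
  (1 - b) ^+ l <= 1 - l%:R * b + (l ^ 2)%:R * b ^+ 2.
Proof.
move=> /andP[b0 b1]; rewrite natrX; elim: l => [|l IHl]; first by rewrite expr0; lra.
rewrite [_ ^+ l.+1]exprS -natr1; have l0 : 0 <= l%:R :> R by [].
have b1' : 0 <= 1 - b by lra.
have := ler_wpM2l b1' IHl; have := mulr_ge0 l0 (sqr_ge0 b); have := sqr_ge0 b.
have : 0 <= l%:R ^+ 2 * b ^+ 3 by rewrite mulr_ge0 ?exprn_ge0.
lra.
Qed.

Lemma sum_nat_eq (R : realFieldType) (F : nat -> R) d N : (d < N)%N ->
  \sum_(0 <= l < N) (if l == d then F l else 0) = F d.
Proof. by move=> dN; rewrite -big_mkcond big_nat1_eq dN. Qed.

Section CriticalLaw.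
Variables (R : realType) (p : nat -> R) (k d : nat) (V C : R).
Hypothesis k3 : (3 <= k)%N.
Hypothesis kd : (k <= d)%N.
Hypothesis p_ge0 : forall l, 0 <= p l.
Hypothesis p_mass : forall N, \sum_(0 <= l < N) p l <= 1.
Hypothesis p_mean : forall N, \sum_(0 <= l < N) p l * l%:R <= 1.
Hypothesis p_mean_lim : forall e, 0 < e ->
  exists N0, forall N, (N0 <= N)%N -> 1 - e <= \sum_(0 <= l < N) p l * l%:R.
Hypothesis p_sqr : forall N, \sum_(0 <= l < N) p l * (l ^ 2)%:R <= V.
Hypothesis p_bin : forall N, \sum_(0 <= l < N) p l * 'C(l, k)%:R <= C.
Hypothesis pd_gt0 : 0 < p d.

Let d2 : (1 < d)%N. Proof. by lia. Qed.

(** The first order term is at most [q] because the mean is at most 1, and the letter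
[d] alone supplies a quadratic gain. *)
Lemma gf_lower (q : R) N : 0 <= q <= 1 -> (d < N)%N ->
  \sum_(0 <= l < N) p l * (1 - (1 - q) ^+ l) <= q - p d * q ^+ 2.
Proof.
move=> q01 dN; have /andP[q0 q1] := q01.
have H : \sum_(0 <= l < N) p l * (1 - (1 - q) ^+ l) <=
    \sum_(0 <= l < N) (p l * l%:R * q - (if l == d then p l * q ^+ 2 else 0)).
  apply: ler_sum => l _; case: eqP => [->|_].
    have := ler_wpM2l (p_ge0 d) (bernoulli_le_sqr q01 d2); lra.
  have := ler_wpM2l (p_ge0 l) (bernoulli_le l q01); lra.
apply: le_trans H _; rewrite sumrB (sum_nat_eq (fun l => p l * q ^+ 2)) //.
by rewrite -mulr_suml lerD2r ler_piMl.
Qed.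

(** A truncated sum has to be compared with the whole series first: cutting the
mean alone would spoil the coefficient of [b]. *)
Lemma gf_upper (b : R) N : 0 <= b <= 1 ->
  \sum_(0 <= l < N) p l * (1 - b) ^+ l <= 1 - b + V * b ^+ 2.
Proof.
move=> b01; have /andP[b0 b1] := b01.
apply/ler_addgt0Pr => e e0.
have [N0 meanN0] := p_mean_lim e0.
pose M := maxn N N0.
have -> : 1 - b + V * b ^+ 2 + e = 1 - b + e + V * b ^+ 2 by ring.
apply: (@le_trans _ _ (\sum_(0 <= l < M) p l * (1 - b) ^+ l)).
  rewrite (@big_cat_nat _ _ _ N 0 M) ?leq_maxl //= lerDl sumr_ge0 // => l _.
  by rewrite mulr_ge0 // exprn_ge0 //; lra.
apply: (@le_trans _ _ (\sum_(0 <= l < M)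
    (p l - b * (p l * l%:R) + p l * (l ^ 2)%:R * b ^+ 2))).
  apply: ler_sum => l _.
  have := ler_wpM2l (p_ge0 l) (expr1B_le l b01); lra.
rewrite big_split sumrB /= -mulr_sumr -mulr_suml.
have := meanN0 M (leq_maxr _ _).
have := p_mass M; have := ler_wpM2r (sqr_ge0 b) (p_sqr M).
set m := \sum_(0 <= l < M) p l; set n := \sum_(0 <= l < M) p l * l%:R.
move=> H1 H2 H3; have : b * (1 - e) <= b * n by rewrite ler_wpM2l.
have : b * e <= e by rewrite ler_piMl // ltW.
lra.
Qed.

Definition mass_ge N h m : R :=
  \sum_(t <- trees N h | (m <= register k t)%N) tree_wt p t.

Let k0 : (0 < k)%N. Proof. by lia. Qed.

Let mass_trees N h : \sum_(t <- trees N h) tree_wt p t <= 1.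
Proof. by apply: (@sum_trees_le1 _ p _ N h predT). Qed.

Let tree_p_ge0 t : 0 <= tree_wt p t. Proof. exact: tree_wt_ge0. Qed.

(** Each level of the register function costs at least one generation, so this is the
classical decay of the survival probability of a critical process; it only has
to bring [mass_ge] below any fixed threshold. *)
Lemma mass_ge_le_inv N h m : (d < N)%N -> mass_ge N h m <= (1 + p d * m%:R)^-1.
Proof.
move=> dN; elim: m h => [|m IHm] h.
  by rewrite mulr0 addr0 invr1 /mass_ge; apply: sum_trees_le1.
have m0 : 0 <= m%:R :> R by [].
have den0 n : 0 < 1 + p d * n%:R by rewrite ltr_pwDl // mulr_ge0.
case: h => [|h]; first by rewrite /mass_ge big_nil invr_ge0 ltW.
set e := (1 + p d * m%:R)^-1 in IHm.
have e01 : 0 <= e <= 1.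
  by rewrite invr_ge0 ltW //= invf_le1 // lerDl mulr_ge0.
rewrite /mass_ge sum_trees.
apply: (@le_trans _ _ (e - p d * e ^+ 2)).
  apply: le_trans (gf_lower e01 dN); apply: ler_sum => l _.
  rewrite ler_wpM2l //.
  apply: le_trans (sum_lprod_has tree_p_ge0 (mass_trees N h) _ _ (IHm h)).
    apply: le_sum_pred => [ts|ts]; first exact: wt_ge0.
    rewrite register_gt // => /orP[|count_k].
      by apply: sub_has => t /ltnW.
    by rewrite has_count (leq_trans k0).
  by case/andP: e01.
rewrite -[leRHS]div1r ler_pdivlMr // -natr1.
have De : (1 + p d * m%:R) * e = 1 by rewrite mulfV // gt_eqF.
have -> : (e - p d * e ^+ 2) * (1 + p d * (m%:R + 1)) =
   ((1 + p d * m%:R) * e) + p d * e - p d * e * ((1 + p d * m%:R) * e)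
   - p d ^+ 2 * e ^+ 2 by ring.
rewrite De; have := mulr_ge0 (sqr_ge0 (p d)) (sqr_ge0 e); lra.
Qed.

(** [B] is a barrier for the recursion in the height: if the mass at level [m.+1] is
at most [B] at height [h], it is at most [B - p d * B ^+ 2 + C * q ^+ k <= B] at
height [h.+1]. *)
Lemma mass_ge_step N m (q B : R) : (d < N)%N ->
  (forall h, mass_ge N h m <= q) -> 0 <= B <= 1 -> C * q ^+ k <= p d * B ^+ 2 ->
  forall h, mass_ge N h m.+1 <= B.
Proof.
move=> dN Qq B01 CB; have /andP[B0 B1] := B01.
elim=> [|h IHh]; first by rewrite /mass_ge big_nil.
have q0 : 0 <= q by apply: le_trans (Qq h); apply: sumr_ge0.
rewrite /mass_ge sum_trees.
apply: (@le_trans _ _ (\sum_(0 <= l < N)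
    (p l * (1 - (1 - B) ^+ l) + p l * 'C(l, k)%:R * q ^+ k))).
  apply: ler_sum => l _; rewrite -mulrA -mulrDr ler_wpM2l //.
  apply: le_trans (lerD (sum_lprod_has tree_p_ge0 (mass_trees N h) l B1 IHh)
     (sum_lprod_count tree_p_ge0 (mass_trees N h) l k (Qq h))).
  rewrite [leLHS]big_mkcond.
  rewrite [X in _ <= X + _]big_mkcond [X in _ <= _ + X]big_mkcond -big_split /=.
  apply: ler_sum => ts _; rewrite register_gt //.
  have w0 := wt_ge0 ts tree_p_ge0.
  by case: (has _ _); case: (k <= _)%N => /=; rewrite ?add0r ?addr0 ?lerDl.
rewrite big_split /= -mulr_suml.
have := gf_lower B01 dN; have := ler_wpM2r (exprn_ge0 k q0) (p_bin N); lra.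
Qed.

(** The scale [be] satisfies [C * be ^+ k <= p d * be ^+ 2], which is what carries the
barrier from [be * exp (- (k/2)^i)] to the next level. *)
Lemma mass_ge_doubly_exp : exists m0, forall N h j, (d < N)%N ->
  mass_ge N h (m0 + j) <= expR (- (k%:R / 2) ^+ j).
Proof.
pose C1 := 1 + `|C|; have C1_1 : 1 <= C1 by rewrite lerDl.
have CC1 : C <= C1 by have := ler_norm C; rewrite /C1; lra.
have pd1 : p d <= 1.
  have := p_mass d.+1; rewrite big_nat_recr //=.
  have : 0 <= \sum_(0 <= l < d) p l by apply: sumr_ge0.
  by lra.
pose be := p d / C1.
have be0 : 0 < be by rewrite divr_gt0 //; lra.
have be1 : be <= 1 by rewrite ler_pdivrMr; lra.
pose m0 := Num.truncn ((be * expR (-1))^-1 / p d).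
exists m0.+1 => N h j dN.
suff H i : forall h, mass_ge N h (m0.+1 + i) <= be * expR (- (k%:R / 2) ^+ i).
  apply: le_trans (H j h) _; by rewrite ler_piMl // ltW ?expR_gt0.
elim: i => {h} [|i IHi] h.
  rewrite addn0 expr0; apply: le_trans (mass_ge_le_inv _ _ dN) _.
  have be' : 0 < be * expR (-1) by rewrite mulr_gt0 ?expR_gt0.
  have := truncnS_gt ((be * expR (-1))^-1 / p d).
  rewrite -/m0 ltr_pdivrMr // => H.
  rewrite invf_ple ?posrE // ; last by rewrite ltr_pwDl // mulr_ge0.
  lra.
rewrite addnS; apply: (mass_ge_step dN IHi).
  rewrite mulr_ge0 ?expR_ge0 ?(ltW be0) //= mulr_ile1 ?expR_ge0 ?(ltW be0) //.
rewrite ![(be * _) ^+ _]exprMn -!expRM_natl !mulrN.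
have -> : 2%:R * (k%:R / 2) ^+ i.+1 = k%:R * (k%:R / 2) ^+ i :> R.
  by rewrite exprS; field.
rewrite [C * _]mulrA [p d * (_ * expR _)]mulrA ler_wpM2r ?expR_ge0 //.
have -> : k = (k - 3).+3 by lia.
have be_k : be ^+ (k - 3) <= 1 by apply: exprn_ile1 => //; exact: ltW.
have Cbe : C1 * be = p d by rewrite mulrCA mulfV ?mulr1 // gt_eqF //; lra.
apply: (@le_trans _ _ (C1 * be ^+ (k - 3).+3)).
  by rewrite ler_wpM2r // exprn_ge0 // ltW.
rewrite exprS mulrA Cbe ler_wpM2l ?(ltW pd_gt0) // -addn2 exprD.
by rewrite ler_piMl ?exprn_ge0 ?(ltW be0).
Qed.

Lemma tree_wt_scale (z : R) t :
  tree_wt (fun l => z * p l) t = z ^+ otree_size t * tree_wt p t.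
Proof.
rewrite -size_code /tree_wt; elim: (code t) => [|l x IHx].
  by rewrite !wt_nil expr0 mul1r.
by rewrite !wt_cons IHx /= exprS; ring.
Qed.

(** The generating function at [z] of the sizes of the trees below level [m]. *)
Definition mass_lt (z : R) N h m : R :=
  \sum_(t <- trees N h | (register k t < m)%N) tree_wt (fun l => z * p l) t.

(** Lower bound for the probability that the root has [d] children of which the first
[k] reach level [m] and none reaches [m.+1], divided by the [k]-th power of the
gap [a]; the factors 2 come from [a - b >= a / 2] and [1 - b >= 1 / 2]. *)
Let c : R := p d / 2 ^+ d.

(** Below level [m.+1] the root may not have [k] children at level [m], and this
removes [c * a ^+ k] from [1 - b + V * b ^+ 2].  With [b ^+ 2] small against
[a ^+ k], half of what is removed pays for the quadratic term and the other half
for the factor [z].  Thus [1 - b] is a barrier for the recursion in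
the height. *)
Lemma mass_lt_step (z : R) N m (a b : R) : (d < N)%N ->
  (forall h, mass_lt z N h m <= 1 - a) ->
  0 <= b -> 2 * b <= a -> a <= 1 ->
  2 * V * b ^+ 2 <= c * a ^+ k -> 0 <= z -> z <= 1 + c / 2 * a ^+ k ->
  forall h, mass_lt z N h m.+1 <= 1 - b.
Proof.
move=> dN Sa b0 ba a1 Vb z0 z1.
have c0 : 0 < c by rewrite divr_gt0 // exprn_gt0.
elim=> [|h IHh]; first by rewrite /mass_lt big_nil; lra.
have g0 l : 0 <= z * p l by rewrite mulr_ge0.
have tg0 t : 0 <= tree_wt (fun l => z * p l) t by exact: tree_wt_ge0.
rewrite /mass_lt sum_trees.
pose A t := (register k t < m.+1)%N.
pose B t := (m <= register k t)%N.
have AB ts : (register k (Node ts) < m.+1)%N = all A ts && (count B ts < k)%N.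
  rewrite ltnS leqNgt register_gt // negb_or -ltnNge -all_predC; congr (_ && _).
  by apply: eq_all => t; rewrite /A /= ltnS -leqNgt.
have massA : \sum_(t <- trees N h | A t) tree_wt (fun l => z * p l) t <= 1 - b.
  exact: IHh.
have massAB : \sum_(t <- trees N h | A t && ~~ B t) tree_wt (fun l => z * p l) t
    <= 1 - a.
  apply: le_trans (Sa h); apply: le_sum_pred => // t.
  by rewrite /A /B -ltnNge => /andP[].
apply: (@le_trans _ _ (z * \sum_(0 <= l < N)
   (p l * (1 - b) ^+ l - (if l == d then p l * (a ^+ k / 2 ^+ d) else 0)))).
  rewrite mulr_sumr; apply: ler_sum => l _.
  rewrite -mulrA ler_wpM2l // (eq_bigl _ _ AB); case: eqP => [->|_].
    rewrite -mulrBr ler_wpM2l //.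
    apply: le_trans (sum_lprod_all_count tg0 massA massAB _ kd) _; first lra.
    rewrite lerD2l lerN2 -{1}(subnKC kd) exprD invfM mulrA.
    rewrite -expr_div_n -exprVn.
    by apply: ler_pM; rewrite ?exprn_ge0 ?divr_ge0 //; try lra;
       rewrite lerXn2r ?nnegrE; lra.
  rewrite subr0 ler_wpM2l //.
  apply: le_trans (le_sum_pred _ _ (Q := all A) _) _.
  - by move=> ts; apply: wt_ge0.
  - by move=> ts /andP[].
  rewrite sum_lprod_all lerXn2r ?nnegrE ?sumr_ge0 //; lra.
rewrite sumrB (sum_nat_eq (fun l => p l * (a ^+ k / 2 ^+ d))) //.
have -> : p d * (a ^+ k / 2 ^+ d) = c * a ^+ k by rewrite /c; ring.
have b01 : 0 <= b <= 1 by lra.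
have := gf_upper N b01; set G := \sum_(_ <= _ < _) _ => G1.
set y := c * a ^+ k in z1 Vb *.
have y0 : 0 <= y by rewrite mulr_ge0 ?exprn_ge0 ?(ltW c0) //; lra.
have z1' : z <= 1 + y / 2 by rewrite /y; lra.
have H : G - y <= 1 - b - y / 2 by lra.
apply: le_trans (ler_wpM2l z0 H) _.
have [neg|pos] := leP (1 - b - y / 2) 0.
  have := mulr_ge0_le0 z0 neg; lra.
have := ler_wpM2r (ltW pos) z1'; have := mulr_ge0 y0 b0; have := sqr_ge0 y; lra.
Qed.

(** Start from level 0, where the mass vanishes and the gap is 1.  The gaps [a i]
satisfy [a i.+1 ^+ 2 = const * a i ^+ k] with a constant made small through
[e0]. *)
Lemma mass_lt_le1 : exists D E : R, [/\ 0 < D, 0 < E &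
  forall N h m z, (d < N)%N -> 0 <= z ->
    z <= 1 + D * expR (- E * (k%:R / 2) ^+ m) -> mass_lt z N h m <= 1].
Proof.
have c0 : 0 < c by rewrite divr_gt0 // exprn_gt0.
have V0 : 0 <= V.
  by apply: le_trans (p_sqr 0); rewrite big_geq.
(* so large that exp (- e0) times 2 * V is at most c, and exp (- e0) at most 1/2 *)
pose e0 := 1 + 2 * V / c.
have e00 : 1 <= e0 by rewrite lerDl divr_ge0 ?mulr_ge0 // ltW.
have exp_e0 : (1 + e0) * expR (- e0) <= 1.
  by rewrite expRN ler_pdivrMr ?expR_gt0 // mul1r expR_ge1Dx.
pose a i := expR (- (2 * e0 * ((k%:R / 2) ^+ i - 1))).
have k32 : 3 / 2 <= k%:R / 2 :> R.
  by rewrite ler_pM2r ?invr_gt0 // (ler_nat R 3 k).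
have kk1 i : 1 <= (k%:R / 2) ^+ i :> R by rewrite exprn_ege1 //; lra.
have a1 i : a i <= 1.
  rewrite /a -[leRHS]expR0 ler_expR oppr_le0.
  by rewrite mulr_ge0 ?subr_ge0 // mulr_ge0 // (le_trans ler01).
exists (c / 2), (2 * e0 * k%:R); split; first by rewrite divr_gt0.
  by rewrite mulr_gt0 ?ltr0n // mulr_gt0 // (lt_le_trans ltr01).
move=> N h m z dN z0 z1.
suff H i : (i <= m)%N -> forall h, mass_lt z N h i <= 1 - a i.
  apply: le_trans (H m (leqnn m) h) _; have := expR_ge0 (- (2 * e0 * ((k%:R / 2) ^+ m - 1))).
  by rewrite -/(a m); lra.
elim: i => {h} [|i IHi] im h.
  by rewrite /mass_lt big_pred0 // /a expr0 subrr mulr0 oppr0 expR0 subrr.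
have xS : (k%:R / 2) ^+ i.+1 = k%:R / 2 * (k%:R / 2) ^+ i :> R by rewrite exprS.
have key : a i.+1 ^+ 2 <= expR (- e0) * a i ^+ k.
  rewrite /a -!expRM_natl -expRD ler_expR xS.
  have k3' : 3 <= k%:R :> R by rewrite (ler_nat R 3 k).
  set x := (k%:R / 2) ^+ i; nra.
have key' : a i.+1 <= expR (- e0) * a i.
  rewrite /a -expRD ler_expR xS; have := kk1 i.
  set x := (k%:R / 2) ^+ i => x1.
  have k1 : 0 <= k%:R / 2 - 3 / 2 :> R by rewrite subr_ge0.
  have e0' : 0 <= e0 by lra.
  have x0 : 0 <= x by lra.
  have x1' : 0 <= x - 1 by lra.
  have := mulr_ge0 e0' (mulr_ge0 k1 x0); have := mulr_ge0 e0' x1'; lra.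
apply: (@mass_lt_step z N i (a i) (a i.+1) dN (IHi (ltnW im))) => //.
- exact: expR_ge0.
- have := ler_wpM2r (expR_ge0 _ : 0 <= a i) exp_e0.
  have : 0 <= (e0 - 1) * (expR (- e0) * a i).
    by rewrite mulr_ge0 ?mulr_ge0 ?expR_ge0 //; lra.
  lra.
- apply: le_trans (ler_wpM2l _ key) _; first by rewrite mulr_ge0.
  rewrite mulrA ler_wpM2r ?exprn_ge0 ?expR_ge0 //.
  have : 2 * V = c * (e0 - 1) by rewrite /e0; field; rewrite gt_eqF.
  move=> ->; rewrite -mulrA ler_piMr ?(ltW c0) //.
  have := expR_ge0 (- e0); lra.
- apply: le_trans z1 _; rewrite lerD2l ler_wpM2l ?divr_ge0 ?(ltW c0) //.
  rewrite /a -expRM_natl ler_expR.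
  have xm : (k%:R / 2) ^+ i <= (k%:R / 2) ^+ m :> R.
    by rewrite ler_eXn2l ?(ltnW im) //; lra.
  have : 0 <= e0 * k%:R by rewrite mulr_ge0 //; lra.
  move: xm; set x := (k%:R / 2) ^+ i; set y := (k%:R / 2) ^+ m => xm ek.
  have := ler_wpM2l ek xm; lra.
Qed.

(** Exponential Markov inequality for the size. *)
Lemma mass_size_lt : exists D E : R, [/\ 0 < D, 0 < E &
  forall N n m, (d < N)%N ->
    \sum_(t <- trees N n | (otree_size t == n) && (register k t < m)%N) tree_wt p t
    <= (1 + D * expR (- E * (k%:R / 2) ^+ m)) ^- n].
Proof.
have [D [E [D0 E0 H]]] := mass_lt_le1; exists D, E; split=> // N n m dN.
set z := 1 + _; have z0 : 0 < z by rewrite ltr_pwDl // mulr_ge0 ?expR_ge0 ?ltW.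
have := H N n m z dN (ltW z0) (lexx _).
rewrite -[X in _ -> _ <= X]mul1r ler_pdivlMr ?exprn_gt0 //; apply: le_trans.
rewrite mulr_suml /mass_lt [leLHS]big_mkcond [leRHS]big_mkcond.
apply: ler_sum => t _; rewrite tree_wt_scale.
have wz : 0 <= z ^+ otree_size t * tree_wt p t.
  by rewrite mulr_ge0 ?exprn_ge0 ?(ltW z0) // tree_wt_ge0.
by case: eqP => //= [->|_]; case: ifP => // _; rewrite mulrC.
Qed.

End CriticalLaw.

(** * A local lower bound for sums of independent letters *)

Lemma fact_le_expn a i t : (i + t <= a)%N -> ((i + t)`! <= i`! * a ^ t)%N.
Proof.
elim: t => [|t IHt] le_a; first by rewrite addn0 muln1.
rewrite addnS factS expnS mulnCA leq_mul ?IHt //; lia.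
Qed.

(** [a ^ i / i!] is largest at [i = a]; used for both factors of a binomial
weight. *)
Lemma expn_fact_le a i : (a`! * a ^ i <= i`! * a ^ a)%N.
Proof.
case: (leqP i a) => [ia|/ltnW ai].
  have f : (a`! <= i`! * a ^ (a - i))%N by rewrite -{1}(subnKC ia) fact_le_expn ?subnKC.
  apply: leq_trans (leq_mul f (leqnn (a ^ i))) _.
  by rewrite -mulnA -expnD subnK.
rewrite -(subnKC ai); elim: (i - a)%N => [|t IHt]; first by rewrite addn0.
rewrite addnS factS expnS mulnCA -mulnA leq_mul //; lia.
Qed.

Lemma bin_expn_le_mode M i j : (i <= M)%N -> (j <= M)%N ->
  ('C(M, i) * ((M - j) ^ (M - i) * j ^ i) <=
   'C(M, j) * ((M - j) ^ (M - j) * j ^ j))%N.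
Proof.
move=> iM jM.
have H := leq_mul (expn_fact_le j i) (expn_fact_le (M - j) (M - i)).
have Ei := bin_fact iM; have Ej := bin_fact jM.
have f0 : (0 < i`! * (M - i)`! * (j`! * (M - j)`!))%N by rewrite !muln_gt0 !fact_gt0.
rewrite -(leq_pmul2r f0).
set A := 'C(M, i) in Ei *; set B := 'C(M, j) in Ej *.
set x := ((M - j) ^ (M - i))%N in H *; set y := (j ^ i)%N in H *.
set z := ((M - j) ^ (M - j))%N in H *; set w := (j ^ j)%N in H *.
have -> : (A * (x * y) * (i`! * (M - i)`! * (j`! * (M - j)`!)) =
   M`! * (j`! * y * ((M - j)`! * x)))%N by rewrite -Ei; ring.
have -> : (B * (z * w) * (i`! * (M - i)`! * (j`! * (M - j)`!)) =
   M`! * (i`! * w * ((M - i)`! * z)))%N by rewrite -Ej; ring.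
by rewrite leq_mul2l H orbT.
Qed.

(** The binomial law with parameter [j / M] has its mode at [j], so that value has
probability at least [1 / M.+1]. *)
Lemma expn_le_bin_mode M j : (j <= M)%N ->
  (M ^ M <= M.+1 * ('C(M, j) * ((M - j) ^ (M - j) * j ^ j)))%N.
Proof.
move=> jM; rewrite -{1}(subnK jM) expnDn -[M.+1 in leqRHS]card_ord -sum_nat_const.
by apply: leq_sum => i _; apply: bin_expn_le_mode => //; rewrite -ltnS.
Qed.

(** Change of parameter from [j / M] to [th]: the cost is the relative entropy, which
the inequality [1 + x <= exp x] bounds by the chi-square distance. *)
Lemma binomial_lower (R : realType) (th : R) M j : (0 < M)%N -> (j <= M)%N ->
  0 < th < 1 ->
  expR (- ((j%:R - th * M%:R) ^+ 2 / (th * (1 - th) * M%:R))) / M.+1%:R <=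
  'C(M, j)%:R * th ^+ j * (1 - th) ^+ (M - j).
Proof.
move=> M0 jM /andP[th0 th1].
have th1' : 0 < 1 - th by lra.
have M0' : 0 < M%:R :> R by rewrite ltr0n.
have key (x t : R) n : 0 < t -> 0 <= x -> x ^+ n <= t ^+ n * expR (n%:R * (x / t - 1)).
  move=> t0 x0; rewrite expRM_natl -exprMn lerXn2r ?nnegrE //.
    by rewrite mulr_ge0 ?expR_ge0 // ltW.
  by rewrite mulrC -ler_pdivrMr //; have := expR_ge1Dx (x / t - 1); lra.
have k1 := key j%:R (th * M%:R) j (mulr_gt0 th0 M0') (ler0n _ _).
have k2 := key (M - j)%:R ((1 - th) * M%:R) (M - j)%N (mulr_gt0 th1' M0') (ler0n _ _).
have mode : M%:R ^+ M <= M.+1%:R * ('C(M, j)%:R * ((M - j)%:R ^+ (M - j) * j%:R ^+ j)) :> R.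
  by rewrite -!natrX -!natrM ler_nat expn_le_bin_mode.
rewrite expRN ler_pdivrMr ?ltr0n // -div1r ler_pdivrMr ?expR_gt0 //.
rewrite -(ler_pM2r (exprn_gt0 M M0')) mul1r; apply: le_trans mode _.
have : (M - j)%:R ^+ (M - j) * j%:R ^+ j <=
   (((1 - th) * M%:R) ^+ (M - j) * expR ((M - j)%:R * ((M - j)%:R / ((1 - th) * M%:R) - 1)))
   * ((th * M%:R) ^+ j * expR (j%:R * (j%:R / (th * M%:R) - 1))).
  by apply: ler_pM; rewrite ?exprn_ge0.
set Z := (_ * _) => HZ.
have -> : 'C(M, j)%:R * th ^+ j * (1 - th) ^+ (M - j) * M.+1%:R *
  expR ((j%:R - th * M%:R) ^+ 2 / (th * (1 - th) * M%:R)) * M%:R ^+ M =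
  M.+1%:R * ('C(M, j)%:R *
   (((1 - th) * M%:R) ^+ (M - j) * expR ((M - j)%:R * ((M - j)%:R / ((1 - th) * M%:R) - 1))
   * ((th * M%:R) ^+ j * expR (j%:R * (j%:R / (th * M%:R) - 1))))).
  rewrite [in RHS](mulrACA (_ ^+ (M - j))) -expRD.
  have -> : M%:R ^+ M = M%:R ^+ (M - j) * M%:R ^+ j :> R by rewrite -exprD subnK.
  rewrite !exprMn.
  have -> : (M - j)%:R * ((M - j)%:R / ((1 - th) * M%:R) - 1) +
    j%:R * (j%:R / (th * M%:R) - 1) = (j%:R - th * M%:R) ^+ 2 / (th * (1 - th) * M%:R).
    by rewrite natrB //; field; rewrite ?gt_eqF.
  move: (expR _) => e; ring.
by rewrite ler_wpM2l // ler_wpM2l.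
Qed.

Section SecondMoment.
Variables (R : realFieldType) (T : Type) (g v : T -> R) (s : seq T).
Hypothesis g_ge0 : forall x, 0 <= g x.
Hypothesis mass1 : \sum_(x <- s) g x <= 1.
Let m1 := \sum_(x <- s) g x * v x.
Let m2 := \sum_(x <- s) g x * v x ^+ 2.
Let A n := \sum_(xs <- lprod n s) wt g xs * \sum_(x <- xs) v x.

Let mass n : 0 <= \sum_(xs <- lprod n s) wt g xs <= 1.
Proof.
rewrite (@sum_lprod_ge0 _ _ g s g_ge0 n predT) /=.
exact: (@sum_lprod_le1 _ _ g s g_ge0 mass1 n predT).
Qed.

Let AS n : A n.+1 = m1 * (\sum_(xs <- lprod n s) wt g xs) + (\sum_(x <- s) g x) * A n.
Proof.
rewrite /A sum_lprodS /m1 !mulr_suml -big_split; apply: eq_bigr => x _ /=.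
rewrite !mulr_sumr -big_split; apply: eq_bigr => xs _ /=.
by rewrite wt_cons big_cons; ring.
Qed.

Lemma norm_mean_le n : `|A n| <= n%:R * `|m1|.
Proof.
elim: n => [|n IHn]; first by rewrite /A sum_lprod0 big_nil mulr0 normr0 mul0r.
rewrite AS; apply: le_trans (ler_normD _ _) _; rewrite !normrM -natr1 mulrDl addrC mul1r.
have /andP[u0 u1] := mass n.
rewrite (ger0_norm u0) (ger0_norm (sumr_ge0 _ _)) //.
apply: lerD; first by apply: le_trans IHn; rewrite ler_piMl.
by rewrite ler_piMr.
Qed.

(** Expand the square: [n] diagonal terms, and at most [n ^ 2] products of two
means.  A total mass below 1 only decreases both. *)
Lemma second_moment_le n :
  \sum_(xs <- lprod n s) wt g xs * (\sum_(x <- xs) v x) ^+ 2 <=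
  n%:R * m2 + n%:R ^+ 2 * m1 ^+ 2.
Proof.
elim: n => [|n IHn]; first by rewrite sum_lprod0 big_nil; lra.
rewrite sum_lprodS.
set S := \sum_(xs <- lprod n s) _ in IHn.
have -> : \sum_(x <- s) \sum_(xs <- lprod n s) wt g (x :: xs) * (\sum_(y <- x :: xs) v y) ^+ 2
  = m2 * (\sum_(xs <- lprod n s) wt g xs) + 2 * m1 * A n + (\sum_(x <- s) g x) * S.
  rewrite /m2 /m1 -mulrA mulrCA !mulr_suml -!big_split /=; apply: eq_bigr => x _.
  rewrite /A /S !mulr_sumr -!big_split /=; apply: eq_bigr => xs _.
  by rewrite wt_cons big_cons; ring.
have /andP[u0 u1] := mass n.
have m2_0 : 0 <= m2 by apply: sumr_ge0 => x _; rewrite mulr_ge0 ?sqr_ge0.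
have S0 : 0 <= S.
  by apply: sumr_ge0 => xs _; rewrite mulr_ge0 ?sqr_ge0 ?wt_ge0.
have h1 : m2 * (\sum_(xs <- lprod n s) wt g xs) <= m2 by rewrite ler_piMr.
have h2 : (\sum_(x <- s) g x) * S <= S by rewrite ler_piMl.
have h3 : m1 * A n <= n%:R * m1 ^+ 2.
  apply: le_trans (ler_norm _) _; rewrite normrM -[m1 ^+ 2]ger0_norm ?sqr_ge0 //.
  have := ler_wpM2l (normr_ge0 m1) (norm_mean_le n); rewrite normrX expr2; lra.
have : 0 <= n%:R :> R by []. have := sqr_ge0 m1.
rewrite -natr1; lra.
Qed.

End SecondMoment.

(** Only finitely many residues occur; represent each of them once and pad with the
letter 0 to a common length. *)
Lemma residues_by_fixed_length (supp : pred nat) d : supp 0%N -> (0 < d)%N ->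
  exists J b : nat, forall l, all supp l ->
  exists l', [/\ all supp l', size l' = J, sumn l' = sumn l %[mod d] & (sumn l' <= b)%N].
Proof.
move=> supp0 d0.
suff H D : exists J b : nat, forall l, all supp l -> (sumn l %% d < D)%N ->
  exists l', [/\ all supp l', size l' = J, sumn l' = sumn l %[mod d] & (sumn l' <= b)%N].
  have [J [b Hd]] := H d; exists J, b => l supp_l; apply: Hd => //.
  exact: ltn_pmod.
elim: D => [|D [J [b IHD]]]; first by exists 0%N, 0%N.
have pad l n : all supp l -> (size l <= n)%N -> exists l',
    [/\ all supp l', size l' = n & sumn l' = sumn l].
  move=> supp_l l_n; exists (l ++ nseq (n - size l) 0%N).
  rewrite all_cat supp_l all_nseq supp0 orbT size_cat size_nseq subnKC //.
  by rewrite sumn_cat sumn_nseq mul0n addn0.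
have [[l0 [supp_l0 l0D]]|none] := pselect (exists l, all supp l /\ (sumn l %% d)%N = D).
  exists (maxn J (size l0)), (maxn b (sumn l0)) => l supp_l.
  rewrite ltnS leq_eqVlt => /orP[/eqP lD|lD].
    have [l' [supp_l' sz sm]] := pad l0 (maxn J (size l0)) supp_l0 (leq_maxr _ _).
    by exists l'; split => //; rewrite sm ?leq_maxr // l0D lD.
  have [l1 [supp_l1 sz1 sm1 b1]] := IHD l supp_l lD.
  have [|l' [supp_l' sz sm]] := pad l1 (maxn J (size l0)) supp_l1.
    by rewrite sz1 leq_maxl.
  by exists l'; split => //; rewrite sm // (leq_trans b1) // leq_maxl.
exists J, b => l supp_l; rewrite ltnS leq_eqVlt => /orP[/eqP lD|lD].
  by case: none; exists l.
exact: IHD.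
Qed.

Lemma wt_min (R : realFieldType) (p : nat -> R) b J : (forall i, 0 <= p i) ->
  exists2 c, 0 < c & forall l, all (fun i => 0 < p i) l -> size l = J ->
    (sumn l <= b)%N -> c <= wt p l.
Proof.
move=> p0.
have [e e0 He] : exists2 e, 0 < e & forall i, (i <= b)%N -> 0 < p i -> e <= p i.
  elim: b => [|b [e e0 He]].
    have [pp|pp] := ltP 0 (p 0%N).
      by exists (p 0%N) => // i; rewrite leqn0 => /eqP ->.
    by exists 1 => // i; rewrite leqn0 => /eqP -> ; rewrite ltNge pp.
  have [pp|pp] := ltP 0 (p b.+1).
    exists (Num.min e (p b.+1)) => [|i]; first by rewrite lt_min e0.
    rewrite leq_eqVlt => /orP[/eqP -> _|ib pi]; first by rewrite ge_min lexx orbT.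
    by rewrite ge_min He.
  exists e => // i; rewrite leq_eqVlt => /orP[/eqP -> |ib]; last exact: He.
  by rewrite ltNge pp.
exists (e ^+ J); first exact: exprn_gt0.
move=> l; elim: l J => [|i l IHl] [|J] //= => [_ _ _|/andP[pi pl] [sz] lb].
  by rewrite expr0 wt_nil.
rewrite exprS wt_cons; apply: ler_pM; rewrite ?exprn_ge0 ?(ltW e0) //.
  by apply: He => //; lia.
by apply: IHl => //; lia.
Qed.

Section LocalLowerBound.
Variables (R : realType) (p : nat -> R) (d : nat) (V : R).
Hypothesis d1 : (1 < d)%N.
Hypothesis p_ge0 : forall l, 0 <= p l.
Hypothesis p_mass : forall N, \sum_(0 <= l < N) p l <= 1.
Hypothesis p_mass_lim : forall e, 0 < e ->
  exists N0, forall N, (N0 <= N)%N -> 1 - e <= \sum_(0 <= l < N) p l.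
Hypothesis p_mean : forall N, \sum_(0 <= l < N) p l * l%:R <= 1.
Hypothesis p_mean_lim : forall e, 0 < e ->
  exists N0, forall N, (N0 <= N)%N -> 1 - e <= \sum_(0 <= l < N) p l * l%:R.
Hypothesis p_sqr : forall N, \sum_(0 <= l < N) p l * (l ^ 2)%:R <= V.
Hypothesis p0_gt0 : 0 < p 0.
Hypothesis pd_gt0 : 0 < p d.

Let lam : R := p 0 + p d.
Let th : R := p d / lam.
(** The letters 0 and [d] are merged into one, written 0: a merged word together
with independent choices, [d] with probability [th], at its zeros has the law of
a word. *)
Let merged l : R := if l == 0%N then lam else if l == d then 0 else p l.

Let lam0 : 0 < lam. Proof. by rewrite addr_gt0. Qed.
Let th01 : 0 < th < 1.
Proof. by rewrite divr_gt0 //= ltr_pdivrMr // mul1r ltrDr. Qed.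
Let merged_ge0 l : 0 <= merged l.
Proof. by rewrite /merged; case: eqP => [_|_]; [exact: ltW|case: eqP]. Qed.
Let d_neq0 : (d == 0%N) = false. Proof. by lia. Qed.

Lemma sum_merged N (F : nat -> R) : (d < N)%N ->
  \sum_(l <- iota 0 N) merged l * F l =
  \sum_(0 <= l < N) p l * F l + p d * (F 0%N - F d).
Proof.
move=> dN.
have -> : p d * (F 0%N - F d) =
  \sum_(0 <= l < N) (if l == 0%N then p d * F 0%N else 0)
  - \sum_(0 <= l < N) (if l == d then p d * F d else 0).
  rewrite (sum_nat_eq (fun=> p d * F 0%N)) ?(leq_ltn_trans _ dN) //.
  by rewrite (sum_nat_eq (fun=> p d * F d)) // -mulrBr.
rewrite -[iota 0 N]/(iota 0 N) -sumrB -big_split /= /index_iota subn0.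
apply: eq_bigr => l _; rewrite /merged; case: (l =P 0%N) => [->|_].
  by rewrite eq_sym d_neq0 /lam; ring.
by case: eqP => [->|_]; ring.
Qed.

(** Mean of [phi (d * B)] for a binomial variable [B] of parameters [M] and [th],
obtained by revealing the choices one at a time. *)
Fixpoint bin_mean (M : nat) (phi : nat -> R) : R :=
  if M is M'.+1 then
    (1 - th) * bin_mean M' phi + th * bin_mean M' (fun t => phi (d + t)%N)
  else phi 0%N.

Lemma bin_mean_ext M phi psi : phi =1 psi -> bin_mean M phi = bin_mean M psi.
Proof.
elim: M phi psi => [|M IHM] phi psi E /=; first exact: E.
rewrite (IHM _ _ E) (IHM (fun t => phi (d + t)%N) (fun t => psi (d + t)%N)) //.
Qed.

Lemma bin_mean_ge0 M phi : (forall t, 0 <= phi t) -> 0 <= bin_mean M phi.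
Proof.
have /andP[t0 t1] := th01.
elim: M phi => [|M IHM] phi phi0 //=.
by apply: addr_ge0; apply: mulr_ge0; rewrite ?IHM //; lra.
Qed.

Lemma bin_mean_ge M j phi : (forall t, 0 <= phi t) -> (j <= M)%N ->
  'C(M, j)%:R * th ^+ j * (1 - th) ^+ (M - j) * phi (j * d)%N <= bin_mean M phi.
Proof.
have /andP[t0 t1] := th01; have t1' : 0 <= 1 - th by lra.
elim: M j phi => [|M IHM] j phi phi0 jM.
  by move: jM; rewrite leqn0 => /eqP ->; rewrite mul0n !mul1r.
have psi0 t : 0 <= phi (d + t)%N by [].
rewrite /=; case: j jM => [|j] jM.
  have := mulr_ge0 (ltW t0) (bin_mean_ge0 M psi0).
  have := ler_wpM2l t1' (IHM 0%N phi phi0 (leq0n _)).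
  by rewrite !bin0 !subn0 [_ ^+ M.+1]exprS; lra.
have h2 := ler_wpM2l (ltW t0) (IHM j _ psi0 jM).
have -> : 'C(M.+1, j.+1)%:R * th ^+ j.+1 * (1 - th) ^+ (M.+1 - j.+1) * phi (j.+1 * d)%N
  = 'C(M, j.+1)%:R * th ^+ j.+1 * (1 - th) ^+ (M - j) * phi (j.+1 * d)%N
  + th * ('C(M, j)%:R * th ^+ j * (1 - th) ^+ (M - j) * phi (d + j * d)%N).
  by rewrite binS natrD exprS mulSn subSS; ring.
apply: lerD h2.
have [jM'|jM'] := leqP j.+1 M.
  have := ler_wpM2l t1' (IHM j.+1 phi phi0 jM').
  by rewrite -[(M - j)%N](subnSK jM') [_ ^+ (M - j.+1).+1]exprS; lra.
by rewrite bin_small // !mul0r mulr_ge0 ?bin_mean_ge0.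
Qed.

Lemma merge_letters n N (phi : nat -> R) : (d < N)%N ->
  \sum_(x <- lprod n (iota 0 N)) wt p x * phi (sumn x) =
  \sum_(y <- lprod n (iota 0 N)) wt merged y *
     bin_mean (count (pred1 0%N) y) (fun t => phi (sumn y + t)%N).
Proof.
move=> dN; elim: n phi => [|n IHn] phi.
  by rewrite !sum_lprod0 !wt_nil /= addn0.
rewrite !sum_lprodS.
pose G M l := \sum_(y <- lprod n (iota 0 N)) wt merged y *
     bin_mean (M + count (pred1 0%N) y) (fun t => phi (l + (sumn y + t))%N).
have -> : \sum_(l <- iota 0 N) \sum_(x <- lprod n (iota 0 N))
   wt p (l :: x) * phi (sumn (l :: x)) = \sum_(0 <= l < N) p l * G 0%N l.
  rewrite /index_iota subn0; apply: eq_bigr => l _.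
  rewrite /G -(IHn (fun t => phi (l + t)%N)) mulr_sumr; apply: eq_bigr => x _.
  by rewrite wt_cons mulrA.
have -> : \sum_(l <- iota 0 N) \sum_(y <- lprod n (iota 0 N)) wt merged (l :: y) *
    bin_mean (count (pred1 0%N) (l :: y)) (fun t => phi (sumn (l :: y) + t)%N)
  = \sum_(l <- iota 0 N) merged l * G (l == 0%N) l.
  apply: eq_bigr => l _; rewrite /G mulr_sumr; apply: eq_bigr => y _.
  rewrite wt_cons /= -mulrA; congr (_ * (_ * _)); apply: bin_mean_ext => t.
  by rewrite addnA.
rewrite (sum_merged (fun l => G (l == 0%N) l)) // d_neq0.
have GS : lam * G 1%N 0%N = p 0 * G 0%N 0%N + p d * G 0%N d.
  rewrite /G !mulr_sumr -big_split; apply: eq_bigr => y _ /=.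
  rewrite add0n; under [in RHS]bin_mean_ext do rewrite add0n.
  have lam_n0 : lam != 0 by rewrite gt_eqF.
  have -> : p 0 = lam * (1 - th) by rewrite /th mulrBr mulr1 mulrCA mulfV // mulr1 /lam addrK.
  have -> : p d = lam * th by rewrite /th mulrCA mulfV // mulr1.
  rewrite (@bin_mean_ext _ (fun t => phi (0 + (sumn y + (d + t)))%N)
     (fun t => phi (d + (sumn y + t))%N)); last first.
    by move=> t; rewrite add0n addnCA.
  rewrite (@bin_mean_ext _ (fun t => phi (0 + (sumn y + t))%N)
     (fun t => phi (sumn y + t)%N)) //; ring.
have -> : \sum_(0 <= l < N) p l * G (l == 0%N) l =
    \sum_(0 <= l < N) p l * G 0%N l + p 0 * (G 1%N 0%N - G 0%N 0%N).
  have -> : p 0 * (G 1%N 0%N - G 0%N 0%N) =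
    \sum_(0 <= l < N) (if l == 0%N then p 0 * (G 1%N 0%N - G 0%N 0%N) else 0).
    by rewrite (sum_nat_eq (fun=> p 0 * _)) ?(leq_ltn_trans _ dN).
  rewrite -big_split; apply: eq_bigr => l _; case: eqP => [->|_] /=; ring.
move: GS; rewrite /lam; lra.
Qed.


Let lam1 : lam <= 1.
Proof.
have := p_mass d.+1; rewrite big_nat_recr //= big_ltn ?(ltnW d1) //.
have : 0 <= \sum_(1 <= l < d) p l by apply: sumr_ge0.
rewrite /lam; lra.
Qed.

Let V2 : R := (d%:R + 1) ^+ 2 + V + 1.

Let V0 : 0 <= V. Proof. by apply: le_trans (p_sqr 0); rewrite big_geq. Qed.

Lemma centred_sum (T : Type) (f : T -> R) (a : R) (y : seq T) :
  \sum_(l <- y) (f l - a) = \sum_(l <- y) f l - (size y)%:R * a.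
Proof. by rewrite sumrB big_const_seq count_predT iter_addr addr0 mulr_natl. Qed.

(** The mean of a letter given its merged form. *)
Let letter_mean l : R := if l == 0%N then d%:R * th else l%:R.

Lemma sum_letter_mean (y : seq nat) :
  \sum_(l <- y) letter_mean l =
  (sumn y)%:R + d%:R * th * (count (pred1 0%N) y)%:R.
Proof.
elim: y => [|l y IHy]; first by rewrite big_nil /= mulr0 addr0.
rewrite big_cons IHy /= !natrD /letter_mean; case: eqP => [->|_] /=; ring.
Qed.

Lemma sum_zero (y : seq nat) :
  \sum_(l <- y) (l == 0%N)%:R = (count (pred1 0%N) y)%:R :> R.
Proof. by elim: y => [|l y IHy]; rewrite ?big_nil // big_cons IHy -natrD. Qed.

(** Variance bound for the conditional mean of the sum given the merged word.
The error [e] accounts for the truncation of the alphabet. *)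
Lemma merged_second_moment n N (e : R) : (d < N)%N ->
  1 - e <= \sum_(0 <= l < N) p l -> 1 - e <= \sum_(0 <= l < N) p l * l%:R ->
  \sum_(y <- lprod n (iota 0 N)) wt merged y *
    ((sumn y)%:R + d%:R * th * (count (pred1 0%N) y)%:R - n%:R) ^+ 2
  <= n%:R * V2 + n%:R ^+ 2 * e ^+ 2.
Proof.
move=> dN mass_e mean_e.
have e0 : 0 <= e by have := p_mass N; lra.
have dth : d%:R * th * lam = d%:R * p d by rewrite /th; field; rewrite gt_eqF.
have mass_pt : \sum_(l <- iota 0 N) merged l <= 1.
  have := sum_merged (fun=> 1) dN; rewrite subrr mulr0 addr0.
  under eq_bigr do rewrite mulr1; move=> ->.
  by under eq_bigr do rewrite mulr1; exact: p_mass.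
have /andP[t0 t1] := th01.
have d0' : 0 <= d%:R :> R by [].
have dth_le : d%:R * th <= d%:R by rewrite ler_piMr // ltW.
have dth_ge : 0 <= d%:R * th by rewrite mulr_ge0 // ltW.
have m1E : \sum_(l <- iota 0 N) merged l * (letter_mean l - 1) =
    \sum_(0 <= l < N) p l * l%:R - \sum_(0 <= l < N) p l.
  rewrite (sum_merged (fun l => letter_mean l - 1) dN) -sumrB.
  have -> : \sum_(0 <= l < N) p l * (letter_mean l - 1) =
     \sum_(0 <= l < N) (p l * l%:R - p l + (if l == 0%N then p 0 * (d%:R * th) else 0)).
    apply: eq_bigr => l _; rewrite /letter_mean; case: eqP => [->|_]; ring.
  rewrite big_split /= (sum_nat_eq (fun=> p 0 * (d%:R * th))) ?(leq_ltn_trans _ dN) //.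
  by rewrite /letter_mean eqxx d_neq0; move: dth; rewrite /lam; lra.
have m2E : \sum_(l <- iota 0 N) merged l * (letter_mean l - 1) ^+ 2 <= V2.
  rewrite (sum_merged (fun l => (letter_mean l - 1) ^+ 2) dN).
  have : \sum_(0 <= l < N) p l * (letter_mean l - 1) ^+ 2 <=
     \sum_(0 <= l < N) (p l * (l ^ 2)%:R + p l +
         (if l == 0%N then p 0 * (d%:R + 1) ^+ 2 else 0)).
    apply: ler_sum => l _; rewrite /letter_mean natrX; case: eqP => [->|_].
      have H : (d%:R * th - 1) ^+ 2 <= 0%:R ^+ 2 + 1 + (d%:R + 1) ^+ 2.
        have : 0 <= (d%:R * th) * (d%:R - d%:R * th) by rewrite mulr_ge0 ?subr_ge0.
        have := mulr_ge0 d0' (_ : 0 <= d%:R - d%:R * th); rewrite subr_ge0 => /(_ dth_le).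
        nra.
      have := ler_wpM2l (p_ge0 0) H; lra.
    have H : (l%:R - 1) ^+ 2 <= l%:R ^+ 2 + 1 :> R by have := ler0n R l; lra.
    have := ler_wpM2l (p_ge0 l) H; lra.
  rewrite 2!big_split /= (sum_nat_eq (fun=> p 0 * (d%:R + 1) ^+ 2)) ?(leq_ltn_trans _ dN) //.
  rewrite {3 4}/letter_mean eqxx d_neq0.
  have H : (d%:R * th - 1) ^+ 2 - (d%:R - 1) ^+ 2 <= (d%:R + 1) ^+ 2.
    have : 0 <= (d%:R * th) * (d%:R - d%:R * th) by rewrite mulr_ge0 ?subr_ge0.
    have : 0 <= d%:R * (d%:R - d%:R * th) by rewrite mulr_ge0 ?subr_ge0.
    nra.
  have := ler_wpM2l (ltW pd_gt0) H.
  have := ler_wpM2r (sqr_ge0 (d%:R + 1)) lam1.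
  have := p_sqr N; have := p_mass N; rewrite /V2 /lam; lra.
have H := second_moment_le (fun l => letter_mean l - 1) merged_ge0 mass_pt n.
apply: le_trans (le_trans _ H) _.
  rewrite big_seq [leRHS]big_seq; apply: ler_sum => y; rewrite lprodP => /andP[/eqP sz _].
  by rewrite centred_sum sz mulr1 sum_letter_mean.
apply: lerD; first by rewrite ler_wpM2l.
rewrite ler_wpM2l ?sqr_ge0 // m1E.
have := p_mean N; have := p_mass N.
set q := \sum_(0 <= l < N) p l in mass_e *.
set m := \sum_(0 <= l < N) p l * l%:R in mean_e * => q1 m1.
have h1 : 0 <= e - (m - q) by lra.
have h2 : 0 <= e + (m - q) by lra.
have := mulr_ge0 h1 h2; lra.
Qed.

Lemma merged_count_moment n N (e : R) : (d < N)%N ->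
  1 - e <= \sum_(0 <= l < N) p l ->
  \sum_(y <- lprod n (iota 0 N)) wt merged y *
    ((count (pred1 0%N) y)%:R - n%:R * lam) ^+ 2
  <= n%:R + n%:R ^+ 2 * e ^+ 2.
Proof.
move=> dN mass_e.
have e0 : 0 <= e by have := p_mass N; lra.
have ptE : \sum_(l <- iota 0 N) merged l = \sum_(0 <= l < N) p l.
  have := sum_merged (fun=> 1) dN; rewrite subrr mulr0 addr0.
  by under eq_bigr do rewrite mulr1; move=> ->; under eq_bigr do rewrite mulr1.
have mass_pt : \sum_(l <- iota 0 N) merged l <= 1 by rewrite ptE.
have m1E : \sum_(l <- iota 0 N) merged l * ((l == 0%N)%:R - lam) =
   lam * (1 - \sum_(0 <= l < N) p l).
  rewrite -ptE (sum_merged (fun l => (l == 0%N)%:R - lam) dN) ptE d_neq0.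
  have -> : \sum_(0 <= l < N) p l * ((l == 0%N)%:R - lam) =
    \sum_(0 <= l < N) ((if l == 0%N then p 0 else 0) - lam * p l).
    by apply: eq_bigr => l _; case: eqP => [->|_] /=; ring.
  rewrite sumrB (sum_nat_eq (fun=> p 0)) ?(leq_ltn_trans _ dN) // -mulr_sumr.
  by rewrite /= /lam; ring.
have m2E : \sum_(l <- iota 0 N) merged l * ((l == 0%N)%:R - lam) ^+ 2 <= 1.
  apply: le_trans mass_pt; apply: ler_sum => l _; rewrite ler_piMr //.
  have : 0 <= lam * (1 - lam) by rewrite mulr_ge0 ?subr_ge0 // ltW.
  have := lam0; have := lam1; case: (l == 0%N) => /=; lra.
have H := second_moment_le (fun l : nat => (l == 0%N)%:R - lam) merged_ge0 mass_pt n.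
apply: le_trans (le_trans _ H) _.
  rewrite big_seq [leRHS]big_seq; apply: ler_sum => y; rewrite lprodP => /andP[/eqP sz _].
  by rewrite centred_sum sz sum_zero.
apply: lerD; first by rewrite ler_piMr.
rewrite ler_wpM2l ?sqr_ge0 // m1E; have := p_mass N.
set q := \sum_(_ <= _ < _) _ in mass_e * => q1.
have q1' : 0 <= 1 - q by lra.
rewrite lerXn2r ?nnegrE ?mulr_ge0 ?(ltW lam0) //.
have := ler_wpM2r q1' lam1; lra.
Qed.


(** The merged words that leave to the binomial choices a target within their
fluctuations, which are of order sqrt n. *)
Definition typical (K : R) n (y : seq nat) : bool :=
  (((sumn y)%:R + d%:R * th * (count (pred1 0%N) y)%:R - n%:R) ^+ 2 <= K * n%:R)
  && (n%:R * lam / 2 <= (count (pred1 0%N) y)%:R).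

Lemma typical_mass : exists K n0, 0 < K /\ forall n, (n0 <= n)%N -> exists N0,
  forall N, (N0 <= N)%N ->
  1 / 2 <= \sum_(y <- lprod n (iota 0 N) | typical K n y) wt merged y.
Proof.
pose K := 4 * (V2 + 1).
have V2_0 : 0 < V2 by have := sqr_ge0 (d%:R + 1 : R); have := V0; rewrite /V2; lra.
exists K, (Num.truncn (64 / lam ^+ 2)).+1; split; first by rewrite /K; lra.
move=> n n_ge.
have n_lam : 64 <= n%:R * lam ^+ 2.
  rewrite -ler_pdivrMr ?exprn_gt0 // (le_trans (ltW (truncnS_gt _))) //.
  by rewrite ler_nat.
have n1 : 1 <= n%:R :> R by rewrite (ler_nat R 1) (leq_trans _ n_ge).
pose e : R := (8 * n%:R)^-1.
have n8 : 0 < 8 * n%:R :> R by lra.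
have e0 : 0 < e by rewrite invr_gt0.
have ne : n%:R * e = 1 / 8 by rewrite /e; field; rewrite gt_eqF //; lra.
have [N1 mass_e] := p_mass_lim e0; have [N2 mean_e] := p_mean_lim e0.
exists (maxn d.+1 (maxn N1 N2)) => N; rewrite !geq_max => /and3P[dN N1N N2N].
have := merged_second_moment n dN (mass_e N N1N) (mean_e N N2N).
have := merged_count_moment n dN (mass_e N N1N).
rewrite -exprMn ne.
set W := fun y : seq nat => (sumn y)%:R + d%:R * th * (count (pred1 0%N) y)%:R - n%:R.
set Z := fun y : seq nat => (count (pred1 0%N) y)%:R - n%:R * lam.
rewrite -/(W _) -/(Z _).
set SZ := \sum_(y <- _) _ * (_ - n%:R * lam) ^+ 2.
set SW := \sum_(y <- _) _ => HZ HW.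
have Kn : 0 < K * n%:R by rewrite mulr_gt0 // /K; lra.
have nl : 0 < (n%:R * lam / 2) ^+ 2 by rewrite exprn_gt0 // !mulr_gt0 // (lt_le_trans ltr01).
have cheb : (\sum_(0 <= l < N) p l) ^+ n - SW / (K * n%:R) - SZ / (n%:R * lam / 2) ^+ 2
   <= \sum_(y <- lprod n (iota 0 N) | typical K n y) wt merged y.
  have ptE : \sum_(l <- iota 0 N) merged l = \sum_(0 <= l < N) p l.
    have := sum_merged (fun=> 1) dN; rewrite subrr mulr0 addr0.
    by under eq_bigr do rewrite mulr1; move=> ->; under eq_bigr do rewrite mulr1.
  rewrite -ptE -sum_lprod_wt /SW /SZ !mulr_suml -!sumrB [leRHS]big_mkcond.
  apply: ler_sum => y _.
  have w0 := wt_ge0 y merged_ge0.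
  rewrite /= -/(W y) -/(Z y).
  rewrite (_ : _ - _ = wt merged y * (1 - W y ^+ 2 / (K * n%:R) - Z y ^+ 2 / (n%:R * lam / 2) ^+ 2)); last by rewrite /W /Z; ring.
  have a0 : 0 <= W y ^+ 2 / (K * n%:R) by rewrite divr_ge0 ?sqr_ge0 ?ltW.
  have b0 : 0 <= Z y ^+ 2 / (n%:R * lam / 2) ^+ 2 by rewrite divr_ge0 ?sqr_ge0 ?ltW.
  rewrite /typical -/(W y); case: ifP => [_|bad].
    have := mulr_ge0 w0 a0; have := mulr_ge0 w0 b0; lra.
  have : 1 <= W y ^+ 2 / (K * n%:R) + Z y ^+ 2 / (n%:R * lam / 2) ^+ 2.
    move/negbT: bad; rewrite negb_and -!ltNge => /orP[bad|bad].
      by rewrite -[leLHS]addr0 lerD // ler_pdivlMr // mul1r ltW.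
    rewrite -[leLHS]add0r lerD // ler_pdivlMr // mul1r -[leRHS]sqrrN.
    have c0 := ler0n R (count (pred1 0%N) y).
    by apply: lerXn2r; rewrite ?nnegrE /Z; lra.
  move=> ab; have := ler_wpM2l w0 ab; lra.
apply: le_trans cheb.
have m1 : 7 / 8 <= (\sum_(0 <= l < N) p l) ^+ n.
  have := mass_e N N1N; have := p_mass N.
  set q := \sum_(_ <= _ < _) _ => q1 q2.
  have q01 : 0 <= 1 - q <= 1 by have : e <= 1 / 8 by [rewrite -ne ler_peMl // ltW]; lra.
  have := bernoulli_le n q01; rewrite subKr.
  have : n%:R * (1 - q) <= n%:R * e by rewrite ler_wpM2l //; lra.
  lra.
have m2 : SW / (K * n%:R) <= 1 / 4.
  rewrite ler_pdivrMr // (le_trans HW) //; have := mulr_ge0 (ltW V2_0) (ler0n R n); rewrite /K; lra.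
have m3 : SZ / (n%:R * lam / 2) ^+ 2 <= 1 / 8.
  rewrite ler_pdivrMr // (le_trans HZ) //.
  have n0 : 0 <= n%:R :> R by []. have := ler_wpM2l n0 n_lam; lra.
lra.
Qed.


(** The binomial sum takes the value [a - b] with probability at least of order
[1 / n] as soon as this lies within order sqrt n of the mean and is a multiple of
[d].  The distance to the mean also forces [a - b] to be between [0] and [d * M]. *)
Lemma bin_mean_window (K : R) : 0 < K -> exists c n0, 0 < c /\
  forall n M a b phi, (n0 <= n)%N -> (M <= n)%N -> n%:R * lam / 2 <= M%:R ->
    (forall t, 0 <= phi t) -> a = b %[mod d] ->
    (a%:R - b%:R - d%:R * th * M%:R) ^+ 2 <= K * n%:R ->
    (b <= a)%N /\ c / n.+1%:R * phi (a - b)%N <= bin_mean M phi.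
Proof.
move=> K0; have /andP[t0 t1] := th01; have t1' : 0 < 1 - th by lra.
have lam_gt0 := lam0.
pose K3 : R := 2 * K / (th * (1 - th) * lam).
pose n2 := (Num.truncn (4 * K / (th * lam) ^+ 2)).+1.
pose n3 := (Num.truncn (4 * K / ((1 - th) * lam) ^+ 2)).+1.
exists (expR (- K3)), (maxn 1 (maxn n2 n3)); split; first exact: expR_gt0.
move=> n M a b phi; rewrite !geq_max => /and3P[n1 n2n n3n] Mn M_ge phi0 ab dev.
have n_gt0 : 0 < n%:R :> R by rewrite ltr0n.
have d_real : 1 <= d%:R :> R by rewrite (ler_nat R 1) ltnW.
have d_gt0 : 0 < d%:R :> R by exact: lt_le_trans d_real.
have M0 : 0 < M%:R :> R.
  by apply: lt_le_trans M_ge; rewrite divr_gt0 // mulr_gt0.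
(* a deviation of order M would exceed the allowed one, of order sqrt n *)
have far (x : R) : 0 < x -> 4 * K / (x * lam) ^+ 2 < n%:R ->
    K * n%:R < (d%:R * x * M%:R) ^+ 2.
  move=> x0; rewrite ltr_pdivrMr; last by rewrite exprn_gt0 // mulr_gt0.
  move=> bigx.
  have h1 : x * (n%:R * lam / 2) <= d%:R * x * M%:R.
    rewrite -[leRHS]mulrA; apply: (@le_trans _ _ (x * M%:R)).
      by rewrite ler_wpM2l // ltW.
    by rewrite ler_peMl // mulr_ge0 // ltW.
  have h0 : 0 <= x * (n%:R * lam / 2) by rewrite !mulr_ge0 // ltW.
  apply: lt_le_trans (_ : (x * (n%:R * lam / 2)) ^+ 2 <= _); last first.
    by apply: lerXn2r; rewrite ?nnegrE // (le_trans h0).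
  by have := bigx; rewrite -(ltr_pM2r n_gt0); lra.
have lt_nat (x : R) m : ((Num.truncn x).+1 <= m)%N -> x < m%:R.
  by move=> xm; apply: lt_le_trans (truncnS_gt _) _; rewrite ler_nat.
have far_th := far th t0 (lt_nat _ _ n2n).
have far_th' := far (1 - th) t1' (lt_nat _ _ n3n).
clear far lt_nat n2n n3n n1.
set D : R := a%:R - b%:R in dev.
have dthM : 0 <= d%:R * th * M%:R by rewrite mulr_ge0 // mulr_ge0 // ltW.
have D0 : 0 <= D.
  rewrite leNgt; apply/negP => neg.
  have : (d%:R * th * M%:R) ^+ 2 <= (D - d%:R * th * M%:R) ^+ 2.
    by rewrite -[leRHS]sqrrN; apply: lerXn2r; rewrite ?nnegrE; lra.
  by rewrite leNgt (le_lt_trans dev far_th).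
have D_le : D <= d%:R * M%:R.
  rewrite leNgt; apply/negP => neg.
  have : (d%:R * (1 - th) * M%:R) ^+ 2 <= (D - d%:R * th * M%:R) ^+ 2.
    have h : 0 <= d%:R * (1 - th) * M%:R by rewrite mulr_ge0 // mulr_ge0 // ltW.
    by apply: lerXn2r; rewrite ?nnegrE; lra.
  by rewrite leNgt (le_lt_trans dev far_th').
have le_ba : (b <= a)%N by rewrite -(ler_nat R) -subr_ge0.
split=> //.
have /dvdnP[j jE] : (d %| a - b)%N by rewrite -eqn_mod_dvd //; apply/eqP.
have DE : D = d%:R * j%:R by rewrite -natrM mulnC -jE natrB.
have jM : (j <= M)%N by rewrite -(ler_nat R) -(ler_pM2l d_gt0) -DE.
rewrite jE; apply: le_trans (bin_mean_ge phi0 jM); rewrite ler_wpM2r //.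
have M_pos : (0 < M)%N by rewrite -(ltr_nat R).
apply: le_trans (binomial_lower M_pos jM th01).
apply: ler_pM; rewrite ?expR_ge0 ?invr_ge0 //; last first.
  by rewrite lef_pV2 ?posrE ?ltr0n // ler_nat ltnS.
rewrite ler_expR lerN2 ler_pdivrMr; last first.
  by apply: mulr_gt0 => //; apply: mulr_gt0.
apply: (@le_trans _ _ (K * n%:R)).
  apply: le_trans dev; rewrite DE.
  have -> : d%:R * j%:R - d%:R * th * M%:R = d%:R * (j%:R - th * M%:R) by ring.
  by rewrite exprMn ler_peMl ?sqr_ge0 // exprn_ege1.
have -> : K3 * (th * (1 - th) * M%:R) = K * (2 / lam * M%:R).
  by rewrite /K3; field; rewrite !gt_eqF.
rewrite ler_wpM2l ?(ltW K0) // mulrAC ler_pdivlMr //.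
by move: M_ge; rewrite ler_pdivrMr // [M%:R * 2]mulrC.
Qed.

Lemma merged_support y : 0 < wt merged y -> all (fun i => 0 < p i) y.
Proof.
elim: y => //= l y IHy; rewrite wt_cons => w0.
have w1 : 0 <= wt merged y by exact: wt_ge0.
have [/eqP wy|wy] := boolP (wt merged y == 0); first by rewrite wy mulr0 ltxx in w0.
have wy0 : 0 < wt merged y by rewrite lt0r wy.
move: w0; rewrite IHy // andbT pmulr_lgt0 // /merged.
by case: eqP => [->//|_]; case: eqP; rewrite ?ltxx.
Qed.

Lemma sum_words_split J n N s :
  \sum_(x <- lprod (n + J) (iota 0 N) | sumn x == s) wt p x =
  \sum_(y <- lprod n (iota 0 N)) wt p y *
    \sum_(l <- lprod J (iota 0 N)) wt p l * ((sumn y + sumn l)%N == s)%:R.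
Proof.
rewrite big_mkcond sum_lprodD; apply: eq_bigr => y _.
rewrite mulr_sumr; apply: eq_bigr => l _.
by rewrite sumn_cat wt_cat mulrA; case: (_ == _); rewrite ?mulr1 ?mulr0.
Qed.

(** The last [J] letters are reserved.  Given a typical merged word for the others,
they are chosen so that the missing amount is a multiple of [d], and then the
binomial choices fill it.  The sum [s] is required to be a sum of letters of
positive probability, without which its residue could be out of reach. *)
Lemma local_lower_bound : exists c n0, 0 < c /\
  forall n s, (n0 <= n)%N -> n = s.+1 ->
  (exists l, all (fun i => 0 < p i) l /\ sumn l = s) ->
  exists N0, forall N, (N0 <= N)%N ->
  c / n%:R <= \sum_(x <- lprod n (iota 0 N) | sumn x == s) wt p x.
Proof.
have [J [b res]] :=
  @residues_by_fixed_length (fun i => 0 < p i) d p0_gt0 (ltnW d1).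
have [c0 c0_gt0 wt_c0] := wt_min b J p_ge0.
have [K [n1 [K0 typical_n1]]] := typical_mass.
pose K2 : R := 2 * ((J%:R + b%:R + 1) ^+ 2 + K).
have K2_0 : 0 < K2 by have := sqr_ge0 (J%:R + b%:R + 1 : R); rewrite /K2; lra.
have [c1 [n2 [c1_gt0 window]]] := bin_mean_window K2_0.
exists (c0 * c1 / 4), (J + maxn 1 (maxn n1 n2))%N; split.
  by rewrite divr_gt0 // mulr_gt0.
move=> n s n_ge ns [ls [supp_ls sum_ls]].
pose n' := (n - J)%N.
have : (maxn 1 (maxn n1 n2) <= n')%N by rewrite leq_subRL // (leq_trans _ n_ge) ?leq_addr.
rewrite !geq_max => /and3P[n'1 n1n' n2n'].
have nE : n = (n' + J)%N by rewrite subnK // (leq_trans _ n_ge) // leq_addr.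
have [N0 typical_N0] := typical_n1 n' n1n'.
exists (maxn N0 (maxn d.+1 b.+1)) => N; rewrite !geq_max => /and3P[N0N dN bN].
rewrite {2}nE sum_words_split.
set phi := fun t : nat => \sum_(l <- lprod J (iota 0 N)) wt p l * ((t + sumn l)%N == s)%:R.
rewrite -[leRHS]/(\sum_(y <- lprod n' (iota 0 N)) wt p y * phi (sumn y)).
have phi_ge0 t : 0 <= phi t.
  by apply: sumr_ge0 => l _; rewrite mulr_ge0 ?wt_ge0 //; case: (_ == _).
have phi_ge t l : l \in lprod J (iota 0 N) -> (t + sumn l = s)%N -> wt p l <= phi t.
  move=> l_in tl.
  rewrite /phi (bigD1_seq l) ?lprod_uniq ?iota_uniq //= tl eqxx mulr1.
  rewrite lerDl; apply: sumr_ge0 => l' _.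
  by rewrite mulr_ge0 ?wt_ge0 //; case: (_ == _).
rewrite merge_letters //.
apply: (@le_trans _ _ (\sum_(y <- lprod n' (iota 0 N) | typical K n' y)
   wt merged y * (c0 * c1 / (2 * n%:R)))).
  have A0 : 0 <= c0 * c1 / (2 * n%:R) by rewrite divr_ge0 ?mulr_ge0 // ltW.
  rewrite -mulr_suml; apply: le_trans (ler_wpM2r A0 (typical_N0 N N0N)).
  rewrite le_eqVlt; apply/orP; left; apply/eqP; field.
  by rewrite pnatr_eq0 ns.
rewrite [leLHS]big_mkcond big_seq [leRHS]big_seq; apply: ler_sum => y y_in.
have wy0 := wt_ge0 y merged_ge0.
case: ifP => [|_]; last by rewrite mulr_ge0 // bin_mean_ge0.
have [/eqP ->|wy] := boolP (wt merged y == 0); first by rewrite !mul0r.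
have supp_y : all (fun i => 0 < p i) y by apply: merged_support; rewrite lt0r wy.
move=> /andP[W_le M_ge]; rewrite ler_wpM2l //.
have sz : size y = n' by move: y_in; rewrite lprodP => /andP[/eqP].
(* the residue of s - sumn y is that of s + (d - 1) * sumn y, a sum of letters *)
have supp_all : all (fun i => 0 < p i) (ls ++ flatten (nseq d.-1 y)).
  rewrite all_cat supp_ls /=; elim: (d.-1) => //= m IHm.
  by rewrite all_cat supp_y.
have [l [supp_l szl suml lb]] := res _ supp_all.
have l_in : l \in lprod J (iota 0 N).
  rewrite lprodP szl eqxx /=; apply/allP => i il; rewrite mem_iota add0n /=.
  apply: leq_ltn_trans bN; apply: leq_trans lb.
  by have := nth_le_sumn l (index i l); rewrite nth_index.
set M := count (pred1 0%N) y in W_le M_ge *.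
have Mn' : (M <= n')%N by rewrite -sz count_size.
have cong : s = sumn y + sumn l %[mod d].
  rewrite -modnDmr suml sumn_cat sum_ls modnDmr.
  have -> : sumn (flatten (nseq d.-1 y)) = (d.-1 * sumn y)%N.
    by elim: (d.-1) => //= m IHm; rewrite sumn_cat IHm mulSn.
  have -> : (sumn y + (s + d.-1 * sumn y) = d * sumn y + s)%N.
    by rewrite -{2}(prednK (ltnW d1)) mulSn -addnA (addnC s).
  by rewrite mulnC modnMDl.
have dev : (s%:R - (sumn y + sumn l)%:R - d%:R * th * M%:R) ^+ 2 <= K2 * n'%:R.
  have s_real : s%:R = n'%:R + J%:R - 1 :> R.
    by rewrite -natrD -nE ns -natr1 addrK.
  have sl_real : (sumn l)%:R <= b%:R :> R by rewrite ler_nat.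
  have J0 := ler0n R J; have sl0 := ler0n R (sumn l).
  have n'1' : 1 <= n'%:R :> R by rewrite (ler_nat R 1).
  have -> : s%:R - (sumn y + sumn l)%:R - d%:R * th * M%:R =
    (J%:R - 1 - (sumn l)%:R) - ((sumn y)%:R + d%:R * th * M%:R - n'%:R).
    by rewrite natrD s_real; ring.
  move: W_le; set u := J%:R - 1 - (sumn l)%:R; set w := (_ - n'%:R) => W_le.
  have u2 : u ^+ 2 <= (J%:R + b%:R + 1) ^+ 2.
    have h1 : 0 <= J%:R + b%:R + 1 - u by rewrite /u; lra.
    have h2 : 0 <= J%:R + b%:R + 1 + u by rewrite /u; lra.
    have := mulr_ge0 h1 h2; lra.
  have := sqr_ge0 (u + w).
  have : (J%:R + b%:R + 1) ^+ 2 <= (J%:R + b%:R + 1) ^+ 2 * n'%:R :> R.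
    by rewrite ler_peMr ?sqr_ge0.
  rewrite /K2; lra.
have [le_s] := window n' M s (sumn y + sumn l)%N (fun t => phi (sumn y + t)%N)
  n2n' Mn' M_ge (fun t => phi_ge0 _) cong dev.
apply: le_trans; rewrite [c0 * c1]mulrC -[leLHS]mulrA -[leRHS]mulrA ler_wpM2l ?(ltW c1_gt0) //.
rewrite mulrC; apply: ler_pM; rewrite ?invr_ge0 ?(ltW c0_gt0) //.
  rewrite lef_pV2 ?posrE ?ltr0n ?mulr_gt0 ?ltr0n ?ns // -natrM ler_nat mul2n -addnn.
  by rewrite -addn1 leq_add // -ns leq_subr.
apply: le_trans (phi_ge _ _ l_in _); first exact: wt_c0.
by rewrite -addnA (addnC (_ - _)%N) addnA subnKC.
Qed.

End LocalLowerBound.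

(** * The law of the random tree *)

Local Open Scope classical_set_scope.
Local Open Scope ring_scope.

Fixpoint degree (t : otree) (u : seq nat) : nat :=
  let: Node ts := t in
  if u is j :: v then degree (nth (Node [::]) ts j) v else size ts.

(** In preorder, so that the degrees of the nodes spell the code. *)
Fixpoint nodes (t : otree) : seq (seq nat) :=
  let: Node ts := t in
  [::] :: flatten [seq [seq e.1 :: v | v <- e.2] |
                    e <- zip (iota 0 (size ts)) [seq nodes s | s <- ts]].

Lemma nodes_Node ts : nodes (Node ts) =
  [::] :: [seq j :: v | j <- iota 0 (size ts), v <- nodes (nth (Node [::]) ts j)].
Proof.
rewrite /=; congr (_ :: flatten _).
have sz : size (zip (iota 0 (size ts)) [seq nodes s | s <- ts]) = size ts.
  by rewrite size_zip size_map size_iota minnn.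
apply: (@eq_from_nth _ [::]); first by rewrite !size_map sz size_iota.
move=> i; rewrite size_map sz => i_ts.
rewrite (nth_map (0%N, [::])) ?sz // nth_zip ?size_map ?size_iota //=.
by rewrite !(nth_map 0%N) ?size_iota // nth_iota // (nth_map (Node [::])).
Qed.

Lemma mem_nodes t u : (u \in nodes t) = has_node t u.
Proof.
elim/otree_ind_all: t u => ts IHts u; rewrite nodes_Node inE.
case: u => [|j v] //=; apply/allpairsPdep/andP => [[i [w [i_ts w_in [-> ->]]]]|[j_ts v_in]].
  by move: i_ts; rewrite mem_iota /= => i_ts; rewrite -IHts.
by exists j, v; rewrite mem_iota IHts.
Qed.

Lemma nodes_uniq t : uniq (nodes t).
Proof.
elim/otree_ind_all: t => ts IHts; rewrite nodes_Node /=; apply/andP; split.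
  by apply/allpairsPdep => -[? [? []]].
apply: allpairs_uniq_dep; first exact: iota_uniq.
  by move=> j; rewrite mem_iota => /= j_ts; exact: IHts.
by move=> [i v] [j w] _ _ /= [-> ->].
Qed.

Lemma degree_nodes t : [seq degree t u | u <- nodes t] = code t.
Proof.
elim/otree_ind_all: t => ts IHts; rewrite nodes_Node code_Node /=; congr (_ :: _).
rewrite map_flatten -map_comp; congr flatten.
rewrite -[in RHS](mkseq_nth (Node [::]) ts) -map_comp.
apply/eq_in_map => j; rewrite mem_iota => /= j_ts.
by rewrite -IHts // -map_comp.
Qed.

Lemma has_node_rcons t u j :
  has_node t (rcons u j) = has_node t u && (j < degree t u)%N.
Proof.
elim: u t => [|i u IHu] [ts] /=; first by rewrite andbT.
by rewrite IHu andbA.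
Qed.

Lemma has_node_inj t t' : has_node t =1 has_node t' -> t = t'.
Proof.
elim/otree_ind_all: t t' => ts IHts [ts'] same; congr Node.
have lt_size j : (j < size ts)%N = (j < size ts')%N.
  by have := same [:: j]; rewrite /= !andbT.
have sz : size ts = size ts'.
  by apply/eqP; rewrite eqn_leq leqNgt lt_size ltnn /= leqNgt -lt_size ltnn.
apply: (@eq_from_nth _ (Node [::])) => // j j_ts; apply: IHts => // v.
by have := same (j :: v); rewrite /= -sz j_ts.
Qed.

(** Growing only ever consults the nodes of the tree, so the event is a cylinder. *)
Lemma grown_eq (c : seq nat -> nat) t :
  grown c = [set u | has_node t u] <->
  forall u, u \in nodes t -> c u = degree t u.
Proof.
split=> [grownE u|cE].
  have gE v : grown c v <-> has_node t v.
    by rewrite grownE.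
  rewrite mem_nodes => t_u.
  have lt_c j : (j < c u)%N = (j < degree t u)%N.
    have := has_node_rcons t u j; rewrite t_u /= => <-.
    apply/idP/idP => [j_c|/gE g_uj].
      by apply/gE; apply: grown_child j_c; apply/gE.
    inversion g_uj as [e|v i g_v i_c e]; first by case: u {t_u} e g_uj.
    by have [vu ij] := rcons_inj e; rewrite -vu -ij.
  by apply/eqP; rewrite eqn_leq leqNgt lt_c ltnn /= leqNgt -lt_c ltnn.
apply/seteqP; split=> [u|u] /=.
  elim=> {u} [|u j _ t_u j_c]; first by case: t {cE}.
  by rewrite has_node_rcons t_u -cE ?mem_nodes.
elim/last_ind: u => [_|u j IHu]; first exact: grown_root.
rewrite has_node_rcons => /andP[t_u j_deg]; apply: grown_child; first exact: IHu.
by rewrite cE ?mem_nodes.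
Qed.

Section LawOfTree.
Context (d : measure_display) (Omega : measurableType d) (R : realType).
Variables (P : probability Omega R) (mu : probability nat R).
Variable xi : seq nat -> {RV P >-> nat}.
Hypothesis xi_GW : GW_family mu xi.

Definition offspring_prob l : R := fine (mu [set l]).

Lemma mu_offspring l : mu [set l] = (offspring_prob l)%:E.
Proof. by rewrite /offspring_prob fineK // fin_num_measure. Qed.

Lemma offspring_prob_ge0 l : 0 <= offspring_prob l.
Proof. by apply: fine_ge0; exact: measure_ge0. Qed.

Definition grows_into t : set Omega :=
  [set w | grown (fun u => xi u w) = [set u | has_node t u]].

Lemma grows_intoE t :
  grows_into t = \bigcap_(u in [set` nodes t]) (xi u @^-1` [set degree t u]).
Proof.
apply/seteqP; split=> w /=.
  by move=> /grown_eq H u /= u_in; exact: H.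
by move=> H; apply/grown_eq => u u_in; exact: H.
Qed.

Lemma measurable_grows_into t : measurable (grows_into t).
Proof.
rewrite grows_intoE; apply: fin_bigcap_measurable => // u _.
exact: measurable_funPTI.
Qed.

Lemma prob_grows_into t : P (grows_into t) = (tree_wt offspring_prob t)%:E.
Proof.
have [indep law] := xi_GW.
rewrite grows_intoE (indep _ (fun u => [set degree t u])) ?nodes_uniq //.
rewrite /tree_wt -degree_nodes /wt big_map -prodEFin.
apply: eq_bigr => u _; rewrite -mu_offspring; exact: law.
Qed.

(** Summing over the list [trees N n] is legitimate for every [N >= n], since a tree
with [n] nodes has height and degrees below [n]. *)
Lemma prob_GW_event (D : set otree) n N : (n <= N)%N ->
  P (GW_event xi (D `&` [set t | otree_size t = n])) =
  (\sum_(t <- trees N n | (otree_size t == n) && `[< D t >])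
     tree_wt offspring_prob t)%:E.
Proof.
move=> nN; pose L := [seq t <- trees N n | (otree_size t == n) && `[< D t >]].
have -> : GW_event xi (D `&` [set t | otree_size t = n]) =
    \bigcup_(t in [set` L]) grows_into t.
  apply/seteqP; split=> w /=.
    move=> [t [Dt tn] gt]; exists t => //=.
    rewrite mem_filter tn eqxx /=; apply/andP; split; first exact/asboolP.
    by apply: trees_complete; rewrite tn.
  move=> [t] /=; rewrite mem_filter => /andP[/andP[/eqP tn /asboolP Dt] _] gt.
  by exists t.
rewrite measure_fin_bigcup; [|exact: finite_seq| |].
- rewrite -fsbig_seq ?filter_uniq ?trees_uniq // big_filter -sumEFin.
  by apply: eq_bigr => t _; exact: prob_grows_into.
- move=> t t' _ _ [w [/= gt gt']]; apply: has_node_inj => u.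
  have E : [set u | has_node t u] = [set u | has_node t' u] by rewrite -gt -gt'.
  by apply/idP/idP => H; [have : [set u | has_node t' u] u by rewrite -E
     | have : [set u | has_node t u] u by rewrite E].
- by move=> t _; exact: measurable_grows_into.
Qed.

Lemma GW_size_probE n N : (n <= N)%N ->
  GW_size_prob xi n =
  \sum_(t <- trees N n | otree_size t == n) tree_wt offspring_prob t.
Proof.
move=> nN; rewrite /GW_size_prob -[[set t | _]]setTI (prob_GW_event _ nN) /=.
by apply: eq_bigl => t; rewrite asboolT // andbT.
Qed.

Lemma cond_GW_probE n N D : (n <= N)%N ->
  cond_GW_prob xi n D =
  (\sum_(t <- trees N n | (otree_size t == n) && `[< D t >])
     tree_wt offspring_prob t) / GW_size_prob xi n.
Proof. by move=> nN; rewrite /cond_GW_prob (prob_GW_event _ nN). Qed.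

End LawOfTree.

Section OffspringMoments.
Variables (R : realType) (mu : probability nat R).
Local Notation p := (offspring_prob mu).

Lemma integral_nat (f : nat -> R) : (forall l, 0 <= f l) ->
  (\int[mu]_l (f l)%:E = \sum_(0 <= l <oo) (p l * f l)%:E)%E.
Proof.
move=> f0.
have cover : \bigcup_l [set l] = [set: nat] by apply/seteqP; split=> l // _; exists l.
rewrite -cover ge0_integral_bigcup //=.
- apply: eq_eseriesr => l _.
  rewrite (eq_integral (cst (f l)%:E)); last by move=> x /set_mem ->.
  rewrite integral_cst // mulrC EFinM; congr (_ * _)%E.
  exact: mu_offspring.
- by move=> l _; rewrite lee_fin.
- by move=> i j _ _ [x [/= -> ->]].
Qed.

Lemma partial_sum_le (f : nat -> R) (a : R) N : (forall l, 0 <= f l) ->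
  (\int[mu]_l (f l)%:E <= a%:E)%E -> \sum_(0 <= l < N) p l * f l <= a.
Proof.
move=> f0 int_a; rewrite -lee_fin -sumEFin; apply: le_trans int_a.
rewrite integral_nat //; apply: nneseries_lim_ge => l _ _.
by rewrite lee_fin mulr_ge0 ?offspring_prob_ge0.
Qed.

Lemma partial_sum_ge (f : nat -> R) (a e : R) : (forall l, 0 <= f l) ->
  (\int[mu]_l (f l)%:E = a%:E)%E -> 0 < e ->
  exists N0, forall N, (N0 <= N)%N -> a - e <= \sum_(0 <= l < N) p l * f l.
Proof.
move=> f0 int_a e0.
have pf0 l : 0 <= p l * f l by rewrite mulr_ge0 ?offspring_prob_ge0.
have : (\sum_(0 <= l < n) (p l * f l)%:E)%E @[n --> \oo] --> a%:E.
  rewrite -int_a integral_nat //; apply: is_cvg_nneseries => l _ _.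
  by rewrite lee_fin.
under eq_cvg do rewrite sumEFin.
move=> /fine_cvg /= /cvgrPdist_le /(_ e e0) [N0 _ H].
exists N0 => N N0N; have := H N N0N => /=; rewrite ler_distlC => /andP[]; lra.
Qed.

End OffspringMoments.

(** * Critical offspring laws *)

Lemma bin_le_expn n m : ('C(n, m) <= n ^ m)%N.
Proof.
rewrite -(@leq_pmul2r m`!) ?fact_gt0 // bin_ffact.
apply: (@leq_trans (n ^ m)); last by rewrite leq_pmulr ?fact_gt0.
elim: m => [|m IHm]; first by rewrite ffactn0.
by rewrite ffactnSr expnSr leq_mul // leq_subr.
Qed.

Section OffspringLaw.
Variables (R : realType) (mu : probability nat R).
Local Notation p := (offspring_prob mu).

Lemma offspring_mass_le1 N : \sum_(0 <= l < N) p l <= 1.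
Proof.
under eq_bigr do rewrite -[p _]mulr1.
apply: (@partial_sum_le _ _ (fun=> 1)) => //.
by rewrite integral_cst // mul1e; exact: probability_le1.
Qed.

Lemma offspring_mass_lim (e : R) : 0 < e ->
  exists N0, forall N, (N0 <= N)%N -> 1 - e <= \sum_(0 <= l < N) p l.
Proof.
move=> e0; have [//||N0 H] := @partial_sum_ge R mu (fun=> 1) 1 e _ _ e0.
  by rewrite integral_cst // mul1e; exact: probability_setT.
exists N0 => N N0N; have := H N N0N.
by under eq_bigr do rewrite mulr1.
Qed.

Lemma offspring_mean_le1 N : ('E_mu[(fun i : nat => i%:R)%R] = 1)%E ->
  \sum_(0 <= l < N) p l * l%:R <= 1.
Proof.
rewrite unlock => mean1; apply: partial_sum_le => //.
by rewrite mean1.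
Qed.

Lemma offspring_mean_lim (e : R) : ('E_mu[(fun i : nat => i%:R)%R] = 1)%E -> 0 < e ->
  exists N0, forall N, (N0 <= N)%N -> 1 - e <= \sum_(0 <= l < N) p l * l%:R.
Proof. by rewrite unlock => mean1; apply: partial_sum_ge. Qed.

Lemma offspring_moment_le j (f : nat -> nat) :
  ('E_mu[(fun i : nat => i%:R ^+ j)%R] < +oo)%E -> (forall l, (f l <= l ^ j)%N) ->
  exists C, forall N, \sum_(0 <= l < N) p l * (f l)%:R <= C.
Proof.
rewrite unlock => moment f_le.
exists (fine (\int[mu]_l (l%:R ^+ j)%:E)%E) => N.
apply: (@le_trans _ _ (\sum_(0 <= l < N) p l * l%:R ^+ j)).
  apply: ler_sum => l _; rewrite ler_wpM2l ?offspring_prob_ge0 //.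
  by rewrite -natrX ler_nat.
apply: partial_sum_le => [l|]; first exact: exprn_ge0.
rewrite fineK // ge0_fin_numE //; apply: integral_ge0 => l _.
by rewrite lee_fin exprn_ge0.
Qed.

Lemma offspring_ge k : (0 < mu [set i : nat | (k <= i)%N])%E ->
  exists2 d, (k <= d)%N & 0 < p d.
Proof.
move=> mu_pos; apply: contrapT => none.
have zero l : (k <= l)%N -> mu [set l] = 0%E.
  move=> kl; rewrite mu_offspring; congr (_%:E); apply/eqP; rewrite eq_le offspring_prob_ge0 andbT.
  by rewrite leNgt; apply/negP => pl; apply: none; exists l.
have : mu (\bigcup_(l in [set i : nat | (k <= i)%N]) [set l]) = 0%E.
  rewrite measure_bigcup //; last by move=> i j _ _ [x [/= -> ->]].
  by apply: eseries0 => l _; rewrite inE /= => /zero.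
rewrite bigcup_imset1 image_id => mu0.
by rewrite mu0 ltxx in mu_pos.
Qed.

(** Childless nodes compensate for the nodes with [d > 1] children. *)
Lemma offspring0_gt0 d : ('E_mu[(fun i : nat => i%:R)%R] = 1)%E ->
  (1 < d)%N -> 0 < p d -> 0 < p 0%N.
Proof.
move=> mean1 d1 pd; pose e := p d / 2; have e0 : 0 < e by rewrite divr_gt0.
have [N0 mass] := offspring_mass_lim e0.
pose N := maxn N0 d.+1; have dN : (d < N)%N by rewrite leq_maxr.
have := mass N (leq_maxl _ _); have := offspring_mean_le1 N mean1.
have H : \sum_(0 <= l < N) (p l + (if l == d then p d else 0)
    - (if l == 0%N then p 0%N else 0)) <= \sum_(0 <= l < N) p l * l%:R.
  apply: ler_sum => l _; have pl := offspring_prob_ge0 mu l.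
  have [->|l0] := eqVneq l 0%N; first by rewrite eq_sym gtn_eqF ?(ltnW d1) //; lra.
  have [ld|_] := eqVneq l d.
    have d2 : 2 <= l%:R :> R by rewrite ld (ler_nat R 2).
    have := ler_wpM2l pl d2; rewrite ld; lra.
  have l1 : 1 <= l%:R :> R by rewrite (ler_nat R 1) lt0n.
  have := ler_wpM2l pl l1; lra.
move: H; rewrite sumrB big_split /= (sum_nat_eq (fun=> p d)) //.
rewrite (sum_nat_eq (fun=> p 0%N)) ?(leq_ltn_trans _ dN) //.
by rewrite /e; lra.
Qed.

End OffspringLaw.

(** The code of a tree of positive probability with [n] nodes exhibits [n - 1] as a sum
of letters of positive probability, as the local lower bound requires. *)
Lemma GW_size_prob_lower (R : realType) (mu : probability nat R)
    (dO : measure_display) (Omega : measurableType dO) (P : probability Omega R)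
    (xi : seq nat -> {RV P >-> nat}) (d : nat) (V : R) :
  (1 < d)%N -> 0 < offspring_prob mu d ->
  ('E_mu[(fun i : nat => i%:R)%R] = 1)%E ->
  (forall N, \sum_(0 <= l < N) offspring_prob mu l * (l ^ 2)%:R <= V) ->
  GW_family mu xi ->
  exists c n0, 0 < c /\ forall n, (n0 <= n)%N -> 0 < GW_size_prob xi n ->
    c / n%:R ^+ 2 <= GW_size_prob xi n.
Proof.
move=> d1 pd mean1 sqr GW.
have p0 := offspring0_gt0 mean1 d1 pd.
have [c [n0 [c0 H]]] := local_lower_bound d1 (offspring_prob_ge0 mu)
  (offspring_mass_le1 mu) (@offspring_mass_lim _ mu)
  (fun N => offspring_mean_le1 N mean1)
  (fun e e0 => offspring_mean_lim mean1 e0) sqr p0 pd.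
exists c, n0; split => // n n0n n_pos.
have [t t_size t_pos] : exists2 t, otree_size t = n & 0 < tree_wt (offspring_prob mu) t.
  apply: contrapT => none; move: n_pos; rewrite (GW_size_probE GW (leqnn n)).
  rewrite big1 ?ltxx // => t /eqP tn; apply/eqP.
  have := tree_wt_ge0 (offspring_prob_ge0 mu) t; rewrite le0r => /orP[//|t0].
  by case: none; exists t.
have tE := sumn_code t; rewrite t_size in tE.
have supp : all (fun i => 0 < offspring_prob mu i) (code t).
  move: t_pos; rewrite /tree_wt; elim: (code t) => //= l y IHy; rewrite wt_cons => w0.
  have y0 : 0 < wt (offspring_prob mu) y.
    rewrite lt0r wt_ge0 ?andbT; last exact: offspring_prob_ge0.
    by apply/eqP => y0; rewrite y0 mulr0 ltxx in w0.
  by rewrite IHy // andbT; move: w0; rewrite pmulr_lgt0.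
have [N0 HN0] := H n (sumn (code t)) n0n (esym tE) (ex_intro _ _ (conj supp erefl)).
pose N := maxn N0 n; have nN : (n <= N)%N by rewrite leq_maxr.
have n_gt0 : 0 < n%:R :> R by rewrite ltr0n -tE.
have := HN0 N (leq_maxl _ _).
have := sum_words_le_trees (offspring_prob_ge0 mu) nN.
rewrite -(GW_size_probE GW nN) -tE => upper lower.
have /= := le_trans lower upper.
rewrite tE ler_pdivrMr // => H2.
by rewrite ler_pdivrMr ?exprn_gt0 //; lra.
Qed.

(** * Comparison of the scales *)

Lemma loglog_ge (R : realType) (B : R) :
  exists n1, forall n, (n1 <= n)%N -> B <= ln (log2 n%:R).
Proof.
have ln2 : 0 < ln 2 :> R by rewrite ln_gt0 // ltr1n.
exists (Num.truncn (expR (ln 2 * expR B))).+1 => n n1n.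
have n_ge : expR (ln 2 * expR B) <= n%:R.
  by apply: le_trans (ltW (truncnS_gt _)) _; rewrite ler_nat.
have n0 : 0 < n%:R :> R by apply: lt_le_trans n_ge; exact: expR_gt0.
have log_ge : expR B <= log2 n%:R.
  by rewrite /log2 ler_pdivlMr // mulrC -ler_expR (lnK n0).
by rewrite -ler_expR lnK // posrE (lt_le_trans (expR_gt0 _) log_ge).
Qed.

Lemma expr_expR (R : realType) (x : R) m : 0 < x -> x ^+ m = expR (m%:R * ln x).
Proof. by move=> x0; rewrite expRM_natl lnK. Qed.

Lemma half_le_div8 n : (8 <= n)%N -> (n <= n %/ 8 * 16)%N.
Proof. by have := divn_eq n 8; have := ltn_pmod n (isT : 0 < 8)%N; lia. Qed.

Section Asymptotics.
Variables (R : realType) (ka D E : R) (m0 : nat).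
Hypotheses (ka1 : 1 < ka) (D0 : 0 < D) (E0 : 0 < E).
Let La : R := ln ka.
Let La0 : 0 < La. Proof. exact: ln_gt0. Qed.
Let ka0 : 0 < ka. Proof. exact: lt_trans ltr01 ka1. Qed.
Let ln2 : 0 < ln 2 :> R. Proof. by rewrite ln_gt0 // ltr1n. Qed.

Lemma ln_nat_loglog n : 1 <= ln (log2 n%:R) :> R ->
  ln n%:R = ln 2 * expR (ln (log2 n%:R)) :> R.
Proof.
move=> X1; have L0 : 0 < log2 n%:R :> R.
  rewrite ltNge; apply/negP => neg; have := ln0 neg; lra.
by rewrite lnK // /log2 mulrC divfK // gt_eqF.
Qed.

(** Above the threshold, [ka ^+ K] is at least [(log n)^(1 + delta)] up to a constant,
hence beats [3 log n]. *)
Lemma large_register_tail (de : R) : 0 < de ->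
  exists n1, forall n, (n1 <= n)%N -> exists2 j : nat,
    (forall K : nat, (1 / La + de) * ln (log2 n%:R) < K%:R -> (m0 + j <= K)%N)
    & expR (- ka ^+ j) <= n%:R ^- 3.
Proof.
move=> de0; have deLa : 0 < de * La by rewrite mulr_gt0.
have [n1 Hn1] := loglog_ge (1 + m0%:R * La
   + (3 * ln 2 * ka ^+ m0.+1) / (de * La)).
exists n1.+1 => n n1n; have := Hn1 n (ltnW n1n).
set X := ln (log2 n%:R) => X_ge.
have n0 : 0 < n%:R :> R by rewrite ltr0n (leq_trans _ n1n).
have h1 : 0 <= m0%:R * La by rewrite mulr_ge0 // ltW.
have h2 : 0 <= (3 * ln 2 * ka ^+ m0.+1) / (de * La).
  by rewrite divr_ge0 ?mulr_ge0 ?exprn_ge0 // ltW.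
have lnE : ln n%:R = ln 2 * expR X by apply: ln_nat_loglog; rewrite -/X; lra.
have Xm0 : m0%:R * La <= X by lra.
have Xbig : 3 * ln 2 * ka ^+ m0.+1 <= expR (de * La * X).
  have : (3 * ln 2 * ka ^+ m0.+1) / (de * La) <= X by lra.
  rewrite ler_pdivrMr // => h; have := expR_ge1Dx (de * La * X).
  have := h; rewrite [X * _]mulrC; lra.
pose r := (1 / La + de) * X.
have rLa : r * La = X + de * La * X by rewrite /r; field; rewrite gt_eqF.
have r_m0 : m0%:R <= r.
  rewrite -(ler_pM2r La0) rLa; have := mulr_ge0 (ltW deLa) (_ : 0 <= X).
  have X0 : 0 <= X by lra.
  by move=> /(_ X0); lra.
have m_m0 : (m0 <= Num.truncn r)%N by rewrite truncn_ge_nat // (le_trans _ r_m0).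
exists (Num.truncn r - m0)%N => [K rK|].
  rewrite subnKC // -(ler_nat R) (le_trans _ (ltW rK)) //.
  by rewrite truncn_le // (le_trans _ r_m0).
have -> : n%:R ^- 3 = expR (- (3 * ln n%:R)) :> R.
  by rewrite expRN expRM_natl lnK.
rewrite ler_expR lerN2.
have kam : ka ^+ m0.+1 * ka ^+ (Num.truncn r - m0) = ka ^+ (Num.truncn r).+1.
  by rewrite -exprD addSn subnKC.
have kr : expR X * expR (de * La * X) <= ka ^+ (Num.truncn r).+1.
  rewrite -expRD -rLa (expr_expR _ ka0) ler_expR ler_pM2r //.
  exact: ltW (truncnS_gt _).
rewrite -(ler_pM2l (exprn_gt0 m0.+1 ka0)) kam; apply: le_trans kr.
rewrite lnE; have := ler_wpM2l (expR_ge0 X) Xbig.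
by apply: le_trans; rewrite le_eqVlt; apply/orP; left; apply/eqP; ring.
Qed.

(** Below the threshold, [ka ^+ K] is at most [(log n)^(1 - delta)] up to a constant,
so that [D * exp (- E * ka ^+ m)] is at least [D / sqrt n]. *)
Lemma small_register_tail (de : R) : 0 < de ->
  exists n1, forall n, (n1 <= n)%N -> exists2 m : nat,
    (forall K : nat, K%:R < (1 / La - de) * ln (log2 n%:R) -> (K < m)%N)
    & (1 + D * expR (- E * ka ^+ m)) ^- n <= n%:R ^- 3.
Proof.
move=> de0.
(* capping the exponent keeps r nonnegative *)
pose th := Num.min (de * La) (1 / 2).
have th0 : 0 < th by rewrite lt_min mulr_gt0 //= divr_gt0.
have th_de : th <= de * La by rewrite ge_min lexx.
have th_half : th <= 1 / 2 by rewrite ge_min lexx orbT.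
have [n1 Hn1] := loglog_ge (1 + 2 * E * ka / ln 2 / th).
pose n2 := (Num.truncn ((16 / D) ^+ 8)).+1.
(* (1 + a)^n with a >= D / sqrt n: the eighth power of Bernoulli's bound over n / 8
   steps is of order n^4. *)
exists (maxn 8 (maxn n1 n2)) => n; rewrite !geq_max => /and3P[n8 n1n n2n].
have := Hn1 n n1n; set X := ln (log2 n%:R) => X_ge.
have n0 : 0 < n%:R :> R by rewrite ltr0n (leq_trans _ n8).
have h2 : 0 <= 2 * E * ka / ln 2 / th.
  by rewrite !divr_ge0 ?mulr_ge0 // ltW.
have lnE : ln n%:R = ln 2 * expR X by apply: ln_nat_loglog; rewrite -/X; lra.
have Xbig : 2 * E * ka <= ln 2 * expR (th * X).
  have : 2 * E * ka / ln 2 / th <= X by lra.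
  rewrite ler_pdivrMr // ler_pdivrMr // => h.
  have := expR_ge1Dx (th * X); rewrite -(ler_pM2l ln2); have := ln2; lra.
pose r := (1 - th) * X / La.
have r0 : 0 <= r by rewrite divr_ge0 ?mulr_ge0 ?(ltW La0) //; lra.
exists (Num.truncn r).+1 => [K Kr|].
  have K_r : K%:R < r.
    apply: lt_le_trans Kr _; rewrite /r ler_pdivlMr // mulrAC.
    rewrite ler_wpM2r //; first lra.
    rewrite mulrBl divfK ?gt_eqF //; lra.
  by rewrite -(ltr_nat R) (lt_trans K_r) // truncnS_gt.
set m := (Num.truncn r).+1.
have kam : ka ^+ m <= ka * expR ((1 - th) * X).
  rewrite /m exprS ler_wpM2l ?(ltW ka0) // (expr_expR _ ka0) ler_expR.
  apply: le_trans (_ : r * La <= _); last by rewrite /r divfK // gt_eqF.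
  by rewrite ler_wpM2r ?(ltW La0) // truncn_le.
clearbody m.
have Eka : E * ka ^+ m <= ln n%:R / 2.
  apply: le_trans (ler_wpM2l (ltW E0) kam) _; rewrite lnE.
  have -> : expR X = expR (th * X) * expR ((1 - th) * X).
    by rewrite -expRD; congr expR; ring.
  have := ler_wpM2r (expR_ge0 ((1 - th) * X)) Xbig; lra.
set a := D * _.
have sq : expR (ln n%:R / 2) ^+ 2 = n%:R :> R.
  by rewrite -expRM_natl mulrC divfK ?lnK.
set s := expR (ln n%:R / 2) in sq.
have s0 : 0 < s by exact: expR_gt0.
have a_ge : D <= a * s.
  rewrite /a -mulrA ler_peMr ?(ltW D0) // -expRD -[leLHS]expR0 ler_expR; lra.
have a0 : 0 < a by rewrite mulr_gt0 ?expR_gt0.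
pose q := (n %/ 8)%N.
have q_ge : n%:R / 16 <= q%:R :> R.
  by rewrite ler_pdivrMr // -natrM ler_nat half_le_div8.
have bern : 1 + q%:R * a <= (1 + a) ^+ q.
  elim: (q) => [|i IHi]; first by rewrite expr0 mul0r addr0.
  have a1 : 0 <= 1 + a by lra.
  have := ler_wpM2l a1 IHi; rewrite exprS -natr1.
  have := mulr_ge0 (ler0n R i) (sqr_ge0 a); lra.
have a1n : n%:R ^+ 3 <= (1 + a) ^+ n.
  apply: (@le_trans _ _ ((1 + a) ^+ (q * 8))); last first.
    by apply: ler_weXn2l; [lra|rewrite leq_trunc_div].
  rewrite exprM.
  apply: (@le_trans _ _ ((s * D / 16) ^+ 8)); last first.
    apply: lerXn2r; rewrite ?nnegrE ?exprn_ge0 ?divr_ge0 ?mulr_ge0 ?(ltW s0) ?(ltW D0) //; first lra.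
    apply: le_trans bern; have := ler_wpM2r (ltW a0) q_ge.
    have := ler_wpM2l (ltW s0) a_ge; rewrite -sq; lra.
  have -> : (s * D / 16) ^+ 8 = n%:R ^+ 3 * (n%:R * (D / 16) ^+ 8) by rewrite -sq; ring.
  rewrite ler_peMr ?exprn_ge0 // -ler_pdivrMr ?exprn_gt0 ?divr_gt0 //.
  rewrite div1r -exprVn invf_div; apply: le_trans (ltW (truncnS_gt _)) _.
  by rewrite ler_nat.
by rewrite lef_pV2 ?posrE ?exprn_gt0 //; lra.
Qed.

End Asymptotics.

(** * Convergence in probability *)

Theorem corollary12 (R : realType) (k : nat) (mu : probability nat R)
    (d : measure_display) (Omega : measurableType d) (P : probability Omega R)
    (xi : seq nat -> {RV P >-> nat}) :
  (3 <= k)%N ->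
  ('E_mu[(fun i : nat => i%:R)%R] = 1)%E ->
  (0 < 'V_mu[(fun i : nat => i%:R)%R])%E ->
  ('E_mu[(fun i : nat => i%:R ^+ k.+1)%R] < +oo)%E ->
  (0 < mu [set i : nat | (k <= i)%N])%E ->
  GW_family mu xi ->
  cond_GW_cvg_in_prob xi
    (fun n t => (register k t)%:R / log2 (log2 n%:R))
    (1 / log2 (k%:R / 2)).
Proof.
move=> k3 mean1 _ moment /offspring_ge[deg k_deg p_deg] GW eps eps0.
have deg1 : (1 < deg)%N by rewrite (leq_trans _ k_deg) // ltnW.
pose p := offspring_prob mu; have p_ge0 := offspring_prob_ge0 mu.
have mass1 := offspring_mass_le1 mu.
have mean_le N := offspring_mean_le1 N mean1.
have mean_lim e (e0 : 0 < e) := offspring_mean_lim mean1 e0.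
have [|V sqr] := @offspring_moment_le _ mu k.+1 (fun l => l ^ 2)%N moment.
  by case=> [|l] //; rewrite leq_pexp2l // ltnW // ltnS ltnW.
have [|C binom] := @offspring_moment_le _ mu k.+1 (fun l => 'C(l, k)) moment.
  case=> [|l]; first by rewrite bin0n; case: (k) k3.
  by apply: leq_trans (bin_le_expn _ _) _; rewrite leq_pexp2l.
have [c [n0 [c0 size_lower]]] := GW_size_prob_lower deg1 p_deg mean1 sqr GW.
have [m0 upper] := mass_ge_doubly_exp k3 k_deg p_ge0 mass1 mean_le binom p_deg.
have [D [E [D0 E0 lower]]] :=
  mass_size_lt k3 k_deg p_ge0 mass1 mean_lim sqr p_deg.
have ka1 : 1 < k%:R / 2 :> R.
  by rewrite ltr_pdivlMr // mul1r (ltr_nat R 2).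
have de0 : 0 < eps / ln 2 by rewrite divr_gt0 // ln_gt0 // ltr1n.
have [n1 large] := large_register_tail m0 ka1 de0.
have [n2 small] := small_register_tail ka1 D0 E0 de0.
have [n3 loglog] := loglog_ge (1 : R).
apply/cvgrPdist_le => e e0.
pose n4 := (Num.truncn (2 / (c * e))).+1.
pose n5 := maxn n0 (maxn n1 (maxn n2 (maxn n3 n4))).
exists n5.+1 => // n /= n5n n_pos.
move: (ltnW n5n); rewrite !geq_max => /and5P[n0n n1n n2n n3n n4n].
have n_gt0 : 0 < n%:R :> R by rewrite ltr0n (leq_trans _ n5n).
have [j K_large large_n] := large n n1n.
have [m K_small small_n] := small n n2n.
have X1 := loglog n n3n.
set X := ln (log2 n%:R) in K_large K_small X1.
pose N := maxn n deg.+1; have nN : (n <= N)%N by rewrite leq_maxl.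
have degN : (deg < N)%N by rewrite leq_maxr.
rewrite sub0r normrN (cond_GW_probE GW _ nN).
set num := \sum_(t <- _ | _) _.
have w_ge0 t : 0 <= tree_wt p t by exact: tree_wt_ge0.
have num_le : num <= 2 * n%:R ^- 3.
  have -> : 2 * n%:R ^- 3 = n%:R ^- 3 + n%:R ^- 3 :> R by ring.
  apply: le_trans (lerD (le_trans (upper N n j degN) large_n)
                        (le_trans (lower N n m degN) small_n)).
  rewrite /num /mass_ge [leLHS]big_mkcond.
  rewrite [X in _ <= X + _]big_mkcond [X in _ <= _ + X]big_mkcond -big_split /=.
  apply: ler_sum => t _; have w0 := w_ge0 t.
  case: ifP => [/andP[tn /asboolP Dt]|_]; last first.
    by rewrite addr_ge0 //; case: ifP.
  suff : ((m0 + j <= register k t) || (register k t < m))%N.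
    rewrite tn /= => /orP[->|->]; first by rewrite lerDl; case: ifP.
    by rewrite lerDr; case: ifP.
  have [//|not_large] := boolP (m0 + j <= register k t)%N.
  apply: K_small; rewrite ltNge; apply/negP => ge_small.
  have le_large : (register k t)%:R <= (1 / ln (k%:R / 2) + eps / ln 2) * X.
    by rewrite leNgt; apply: contra not_large; apply: K_large.
  move: Dt; apply/negP; rewrite -leNgt.
  have ln2 : 0 < ln 2 :> R by rewrite ln_gt0 // ltr1n.
  have lnk : 0 < ln (k%:R / 2) :> R by rewrite ln_gt0.
  have X0 : 0 < X by lra.
  have -> : (register k t)%:R / log2 (log2 n%:R) - 1 / log2 (k%:R / 2) =
    ln 2 / X * ((register k t)%:R - X / ln (k%:R / 2)).
    by rewrite /log2 -/(log2 n%:R) -/X; field; rewrite !gt_eqF.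
  rewrite normrM ger0_norm ?divr_ge0 ?(ltW ln2) ?(ltW X0) //.
  have -> : eps = ln 2 / X * (eps / ln 2 * X) by field; rewrite !gt_eqF.
  rewrite ler_wpM2l ?divr_ge0 ?(ltW ln2) ?(ltW X0) // ler_norml.
  lra.
have num_ge0 : 0 <= num by apply: sumr_ge0.
rewrite ger0_norm ?divr_ge0 ?(ltW n_pos) // ler_pdivrMr //.
apply: le_trans num_le _.
apply: le_trans (ler_wpM2l (ltW e0) (size_lower n n0n n_pos)).
have -> : 2 * n%:R ^- 3 = 2 / (c * e) / n%:R * (e * (c / n%:R ^+ 2)).
  by field; rewrite !gt_eqF.
rewrite ler_piMl ?mulr_ge0 ?divr_ge0 ?(ltW e0) ?(ltW c0) ?exprn_ge0 //.
rewrite ler_pdivrMr // mul1r; apply: le_trans (ltW (truncnS_gt _)) _.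
by rewrite ler_nat.
Qed.
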